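(* Let $\mathcal{H}_1,\mathcal{H}_2$ be complex Hilbert spaces and let $A:\mathcal{H}_1\to\mathcal{H}_2$ be a densely defined closed antilinear operator. Then there exists a unique antilinear partial isometry $U_A$ with initial space $\overline{\mathcal{R}(|A|)}$ and final space $\overline{\mathcal{R}(A)}$, called the phase operator of $A$, such that $$A=U_A|A|.$$ Moreover, $(U_A)^\dagger=U_{A^\dagger}$, where $U_{A^\dagger}$ is the phase operator of $A^\dagger$.
   Context: Scalar products are linear in the first variable; operators may be unbounded, with products on natural domains and equalities including domains. $\mathcal{R}(\cdot)$ and $\mathcal{N}(\cdot)$ denote range and kernel. An operator $A$ on a linear subspace $\mathcal{D}(A)$ is antilinear if $A(\alpha x+\beta y)=\overline{\alpha}\,Ax+\overline{\beta}\,Ay$ for $\alpha,\beta\in\mathbb{C}$. For a densely defined antilinear $A:\mathcal{H}_1\to\mathcal{H}_2$, the adjoint $A^\dagger:\mathcal{H}_2\to\mathcal{H}_1$ is the antilinear operator whose domain consists of all $y\in\mathcal{H}_2$ for which there is $u\in\mathcal{H}_1$ with $\langle Ax,y\rangle=\langle u,x\rangle$ for all $x\in\mathcal{D}(A)$; then $A^\dagger y:=u$. For densely defined closed antilinear $A$, the linear operator $A^\dagger A$ is positive and self-adjoint, and $|A|:=\sqrt{A^\dagger A}$ is its positive square root. An antilinear partial isometry is a bounded everywhere defined antilinear operator $U$ with $\|Ux\|=\|x\|$ for $x\in\mathcal{N}(U)^\perp$; its initial space is $\mathcal{N}(U)^\perp$ and its final space is $\mathcal{R}(U)$. *)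

(* Defs.v *)
From HB Require Import structures.
From mathcomp Require Import all_boot all_order all_algebra complex.
From mathcomp Require Import all_classical all_reals all_analysis.

Set Implicit Arguments.
Unset Strict Implicit.
Unset Printing Implicit Defensive.

Import Order.TTheory GRing.Theory Num.Theory numFieldNormedType.Exports.

Local Open Scope classical_set_scope.
Local Open Scope ring_scope.

(* [{dot H for conjC}] is linear in the first variable and conjugate-linear in
   the second one; norms take their values in [R[i]]. *)
HB.mixin Record CompleteNormedModule_isHilbert (R : realType) H
    of CompleteNormedModule R[i] H := {
  inner : {dot H for (@Num.conj R[i])};
  inner_norm : forall x : H, inner x x = `|x| ^+ 2
}.

#[short(type="hilbertType")]
HB.structure Definition Hilbert (R : realType) :=
  {H of CompleteNormedModule_isHilbert R H & CompleteNormedModule R[i] H}.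

Notation "''[' x , y ]" := (inner x y) : ring_scope.

(* A possibly unbounded operator; the values of [app] outside [dom] carry no
   meaning, so operators are compared with [=op] instead of [=]. *)
Record operator (V W : Type) := Operator { dom : set V; app :> V -> W }.

HB.instance Definition _ (V W : Type) := gen_eqMixin (operator V W).
HB.instance Definition _ (V W : Type) := gen_choiceMixin (operator V W).

Definition op_eq (V W : Type) (A B : operator V W) : Prop :=
  dom A = dom B /\ forall x, dom A x -> A x = B x.

Notation "A =op B" := (op_eq A B) (at level 70, no associativity).

Definition everywhere (V W : Type) (f : V -> W) : operator V W :=
  Operator setT f.

Definition comp_op (V W X : Type) (B : operator W X) (A : operator V W) :
    operator V X :=
  Operator [set x | dom A x /\ dom B (A x)] (B \o A).

Definition range_op (V W : Type) (A : operator V W) : set W := A @` dom A.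

Section Operators.
Context {R : realType}.
Implicit Types H K : hilbertType R.

Definition lin_subspace H (D : set H) : Prop :=
  D 0 /\ forall (a b : R[i]) x y, D x -> D y -> D (a *: x + b *: y).

Definition linear_op H K (A : operator H K) : Prop :=
  lin_subspace (dom A) /\
  forall (a b : R[i]) x y, dom A x -> dom A y ->
    A (a *: x + b *: y) = a *: A x + b *: A y.

Definition antilinear_op H K (A : operator H K) : Prop :=
  lin_subspace (dom A) /\
  forall (a b : R[i]) x y, dom A x -> dom A y ->
    A (a *: x + b *: y) = a^* *: A x + b^* *: A y.

Definition densely_defined H K (A : operator H K) : Prop := dense (dom A).

Definition closed_op H K (A : operator H K) : Prop :=
  closed [set p : H * K | dom A p.1 /\ p.2 = A p.1].

Definition adjoint_rel H K (A : operator H K) (y : K) (u : H) : Prop :=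
  forall x, dom A x -> '[A x, y] = '[x, u].

(* Both adjoints are only meaningful for densely defined [A], in which case [u]
   is determined by [y]. *)
Definition adjoint H K (A : operator H K) : operator K H :=
  Operator [set y | exists u, adjoint_rel A y u]
           (fun y => xget 0 [set u | adjoint_rel A y u]).

Definition antiadjoint_rel H K (A : operator H K) (y : K) (u : H) : Prop :=
  forall x, dom A x -> '[A x, y] = '[u, x].

Definition antiadjoint H K (A : operator H K) : operator K H :=
  Operator [set y | exists u, antiadjoint_rel A y u]
           (fun y => xget 0 [set u | antiadjoint_rel A y u]).

Definition selfadjoint H (T : operator H H) : Prop :=
  [/\ linear_op T, densely_defined T & adjoint T =op T].

(* In [R[i]], [0 <= z] means that [z] is real and nonnegative. *)
Definition positive_op H (T : operator H H) : Prop :=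
  forall x, dom T x -> 0 <= '[T x, x].

Definition positive_sqrt H (S T : operator H H) : Prop :=
  [/\ selfadjoint T, positive_op T & comp_op T T =op S].

(* The default value [S] is irrelevant when [S] is positive and selfadjoint,
   since then the positive square root exists and is unique up to [=op]. *)
Definition sqrt_op H (S : operator H H) : operator H H :=
  xget S [set T | positive_sqrt S T].

Definition abs_op H K (A : operator H K) : operator H H :=
  sqrt_op (comp_op (antiadjoint A) A).

Definition null_space H K (U : H -> K) : set H := [set x | U x = 0].

Definition orthocompl H (D : set H) : set H :=
  [set x | forall y, D y -> '[x, y] = 0].

Definition initial_space H K (U : H -> K) : set H := orthocompl (null_space U).

Definition final_space H K (U : H -> K) : set K := range U.

Definition antilinear_partial_isometry H K (U : H -> K) : Prop :=
  [/\ antilinear_op (everywhere U),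
      exists M : R[i], forall x, `|U x| <= M * `|x|
    & forall x, initial_space U x -> `|U x| = `|x| ].

Definition phase_operator H K (A : operator H K) (U : H -> K) : Prop :=
  [/\ antilinear_partial_isometry U,
      initial_space U = closure (range_op (abs_op A)),
      final_space U = closure (range_op A)
    & A =op comp_op (everywhere U) (abs_op A)].

End Operators.

(* Main.v *)
Require Import Defs.
From mathcomp Require Import all_boot all_order all_algebra complex.
From mathcomp Require Import all_classical all_reals all_analysis.
From mathcomp Require Import ring lra.

Set Implicit Arguments.
Unset Strict Implicit.
Unset Printing Implicit Defensive.

Import Order.TTheory GRing.Theory Num.Theory numFieldNormedType.Exports.

Local Open Scope classical_set_scope.
Local Open Scope ring_scope.
Local Open Scope complex_scope.

(* Everything is done over the reals with the inner product Re <x, y>, for which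
   both kinds of adjoint become the ordinary adjoint.  Projecting (x, 0) onto the
   closed graph of A gives the resolvent B = (1 + A^dag A)^-1, a symmetric
   contraction.  Bounded square roots C of B and D of 1 - B come from the iteration
   Y := (X + Y^2) / 2, which transports every bounded intertwiner, and
   T : C x |-> D x is a positive self-adjoint square root of A^dag A.  Any other
   such root T satisfies T B = D C, by uniqueness of bounded positive roots.
   A and |A| have the same resolvent, hence the same domain and the same norms,
   because the range of B is a core for both; the closure of the pairs (|A|x, Ax)
   is then the graph of an isometry, which extended by 0 is the phase operator.
   The operator A B intertwines B with B' = (1 + A A^dag)^-1, hence D C with D' C',
   and this is <U |A|B p, |A^dag|B' q> = <|A|B p, V |A^dag|B' q>, that is, V = U^dag
   on dense sets. *)

(** * The real inner product and its topology *)

(** [abs_op A] is an unspecified choice among the unbounded positive roots of A^dag A, so a root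
    built by hand cannot simply replace it. It is reached through bounded data: any self-adjoint T
    with T T = A^dag A has the same resolvent [B] as A, and |A B x|^2 = <B x, x - B x> depends on
    [B] alone, although A and T take values in different spaces. The iterates are polynomials in X
    with real coefficients. They therefore pass through antilinear maps between two spaces, such as
    A B, and also through complex scalars, which makes the constructed root complex linear. C and D
    behave like a cosine and a sine: they commute and C^2 + D^2 = 1. Hence D y = C u forces (y, u) =
    (C z, D z) for z = C y + D u, which is the maximality needed for self-adjointness. *)

Section RealInner.
Context {R : realType}.
Implicit Types H K : hilbertType R.

(* Hides the coercion path through the Hermitian form, which otherwise blocks
   rewriting. *)
Definition cdot H (x y : H) : R[i] := '[x, y].

Definition rdot H (x y : H) : R := complex.Re (cdot x y).

Definition nrm H (x : H) : R := Num.sqrt (rdot x x).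

Lemma cdotC H (x y : H) : cdot x y = (cdot y x)^*.
Proof. rewrite /cdot [LHS]hermC /= expr0 mul1r; reflexivity. Qed.

Lemma cdotDl H (x y z : H) : cdot (x + y) z = cdot x z + cdot y z.
Proof. exact: linearDl. Qed.

Lemma cdotZl H (a : R[i]) (x y : H) : cdot (a *: x) y = a * cdot x y.
Proof. exact: linearZl_LR. Qed.

Lemma cdotZr H (a : R[i]) (x y : H) : cdot x (a *: y) = a^* * cdot x y.
Proof. by rewrite cdotC cdotZl rmorphM /= -cdotC. Qed.

Lemma cdot_norm H (x : H) : cdot x x = `|x| ^+ 2.
Proof. exact: inner_norm. Qed.

Lemma rdotC H (x y : H) : rdot x y = rdot y x.
Proof. by rewrite /rdot cdotC; case: (cdot y x). Qed.

Lemma rdotDl H (x y z : H) : rdot (x + y) z = rdot x z + rdot y z.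
Proof. by rewrite /rdot cdotDl; case: (cdot x z) => ? ?; case: (cdot y z). Qed.

Lemma rdotDr H (x y z : H) : rdot z (x + y) = rdot z x + rdot z y.
Proof. by rewrite rdotC rdotDl !(rdotC z). Qed.

Lemma rdotZl H (c : R) (x y : H) : rdot (c%:C *: x) y = c * rdot x y.
Proof. by rewrite /rdot cdotZl; case: (cdot x y) => a b /=; rewrite mul0r subr0. Qed.

Lemma rdotZr H (c : R) (x y : H) : rdot x (c%:C *: y) = c * rdot x y.
Proof. by rewrite rdotC rdotZl rdotC. Qed.

Lemma rdotZ_conj H (a : R[i]) (x y : H) :
  rdot (a *: x) y = rdot x (a^* *: y).
Proof. by rewrite /rdot cdotZl cdotZr conjCK. Qed.

Lemma rdotNl H (x y : H) : rdot (- x) y = - rdot x y.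
Proof. by have := rdotZl (-1) x y; rewrite rmorphN1 scaleN1r mulN1r. Qed.

Lemma rdotNr H (x y : H) : rdot x (- y) = - rdot x y.
Proof. by rewrite rdotC rdotNl rdotC. Qed.

Lemma rdot0l H (y : H) : rdot 0 y = 0.
Proof. by have := rdotZl 0 0 y; rewrite scaler0 mul0r. Qed.

Lemma rdot0r H (y : H) : rdot y 0 = 0.
Proof. by rewrite rdotC rdot0l. Qed.

Definition rdotE := (rdotDl, rdotDr, rdotNl, rdotNr, rdotZl, rdotZr, rdot0l, rdot0r).

(** Because <x, i y> = - i <x, y>, the imaginary part is again a real product; this is the way back
    from real identities to complex ones. *)
Lemma cdotE H (x y : H) : cdot x y = rdot x y +i* rdot x ('i *: y).
Proof.
rewrite /rdot cdotZr; case: (cdot x y) => a b /=.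
by rewrite mul0r !mulN1r sub0r opprK.
Qed.

Lemma cdot_ge0 H (x : H) : 0 <= cdot x x.
Proof. by rewrite cdot_norm exprn_ge0. Qed.

Lemma rdot_ge0 H (x : H) : 0 <= rdot x x.
Proof. by have := cdot_ge0 x; rewrite lecE => /andP[]. Qed.

Lemma cdot_self H (x : H) : cdot x x = (rdot x x)%:C.
Proof.
rewrite cdotE; congr (_ +i* _).
by have := cdot_ge0 x; rewrite cdotE lecE /= => /andP[/eqP].
Qed.

Lemma nrm_ge0 H (x : H) : 0 <= nrm x.
Proof. exact: sqrtr_ge0. Qed.

Lemma sqr_nrm H (x : H) : nrm x ^+ 2 = rdot x x.
Proof. exact/sqr_sqrtr/rdot_ge0. Qed.

Lemma normE H (x : H) : `|x| = (nrm x)%:C.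
Proof.
apply: (pexpIrn (n:=2)) => //; rewrite ?nnegrE //; first by rewrite ler0c nrm_ge0.
by rewrite -cdot_norm cdot_self -rmorphXn sqr_nrm.
Qed.

Lemma nrm_eq0 H (x : H) : nrm x = 0 -> x = 0.
Proof. by move=> h; apply/normr0_eq0; rewrite normE h. Qed.

Lemma rdot_eq0 H (x : H) : rdot x x = 0 -> x = 0.
Proof. by move=> h; apply: nrm_eq0; rewrite /nrm h sqrtr0. Qed.

Lemma rdot_inj H (x y : H) : (forall h, rdot x h = rdot y h) -> x = y.
Proof.
move=> h; apply/eqP; rewrite -subr_eq0; apply/eqP/rdot_eq0.
by rewrite rdotDl rdotNl h subrr.
Qed.

Lemma nrm0 H : nrm (0 : H) = 0.
Proof. by rewrite /nrm rdot0l sqrtr0. Qed.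

Lemma nrmD H (x y : H) : nrm (x + y) <= nrm x + nrm y.
Proof. by move: (ler_normD x y); rewrite !normE -rmorphD lecR. Qed.

Lemma nrmN H (x : H) : nrm (- x) = nrm x.
Proof. by rewrite /nrm !rdotE opprK. Qed.

Lemma nrm_distC H (x y : H) : nrm (x - y) = nrm (y - x).
Proof. by rewrite -nrmN opprB. Qed.

Lemma nrmB_trans H (y x z : H) : nrm (x - z) <= nrm (x - y) + nrm (y - z).
Proof. by apply: le_trans (nrmD _ _); rewrite addrA subrK. Qed.

Lemma rdot_le H (x y : H) : `|rdot x y| <= nrm x * nrm y.
Proof.
rewrite -(ler_pXn2r (n:=2)) ?nnegrE ?mulr_ge0 ?nrm_ge0 //.
rewrite exprMn !sqr_nrm -normrX ger0_norm ?sqr_ge0 //.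
have [y0|y0] := eqVneq (rdot y y) 0; first by rewrite (rdot_eq0 y0) !rdotE mulr0 expr0n.
have yp : 0 < rdot y y by rewrite lt_def y0 rdot_ge0.
(* The squared norm of this multiple of the part of [x] orthogonal to [y] is |y|^2 (|x|^2 |y|^2 -
   <x, y>^2). *)
have := rdot_ge0 ((rdot y y)%:C *: x - (rdot x y)%:C *: y).
rewrite !rdotE (rdotC y x) => h.
have : 0 <= rdot y y * (rdot x x * rdot y y - rdot x y ^+ 2) by nra.
by rewrite pmulr_rge0 // subr_ge0.
Qed.

Lemma nrm_leP H K (x : H) (y : K) : rdot x x <= rdot y y -> nrm x <= nrm y.
Proof. by move=> h; rewrite ler_wsqrtr. Qed.

Lemma nrmZ H (a : R[i]) (x : H) : nrm (a *: x) = complex.Re `|a| * nrm x.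
Proof.
by apply: complexI; rewrite -normE normrZ rmorphM /= -normE; congr (_ * _).
Qed.

(** The norm of [H] lives in [R[i]], whose order is partial; convergence is moved to [R], where
    squeezing and limits of inequalities apply. *)
Definition cvgs H (u : nat -> H) (l : H) := (fun n => nrm (u n - l)) @ \oo --> (0 : R).

Lemma cvg_dist_squeeze (a b : nat -> R) (l : R) :
  (forall n, `|a n - l| <= b n) -> b @ \oo --> (0 : R) -> a @ \oo --> l.
Proof.
move=> h hb.
have h1 : (fun n => l - b n) @ \oo --> l.
  by rewrite -[X in _ --> X]subr0; apply: cvgB => //; exact: cvg_cst.
have h2 : (fun n => l + b n) @ \oo --> l.
  by rewrite -[X in _ --> X]addr0; apply: cvgD => //; exact: cvg_cst.
apply: (squeeze_cvgr _ h1 h2); apply: nearW => n.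
by have := h n; rewrite ler_distl.
Qed.

Lemma cvgs_squeeze H (u : nat -> H) l (v : nat -> R) :
  (forall n, nrm (u n - l) <= v n) -> v @ \oo --> (0 : R) -> cvgs u l.
Proof.
move=> h; apply: cvg_dist_squeeze => n.
by rewrite subr0 ger0_norm ?nrm_ge0.
Qed.

Lemma cvgs_cst H (l : H) : cvgs (fun _ => l) l.
Proof. by rewrite /cvgs subrr nrm0; exact: cvg_cst. Qed.

Lemma cvgsD H (u v : nat -> H) l m :
  cvgs u l -> cvgs v m -> cvgs (fun n => u n + v n) (l + m).
Proof.
move=> hu hv; apply: (cvgs_squeeze (v := fun n => nrm (u n - l) + nrm (v n - m))).
  by move=> n; apply: le_trans (nrmD _ _); rewrite opprD addrACA.
by rewrite -[X in _ --> X]addr0; apply: cvgD.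
Qed.

Lemma cvgs_lip H K (f : H -> K) (M : R) (u : nat -> H) l :
  (forall x y, nrm (f x - f y) <= M * nrm (x - y)) ->
  cvgs u l -> cvgs (fun n => f (u n)) (f l).
Proof.
move=> hf hu; apply: (cvgs_squeeze (v := fun n => M * nrm (u n - l))) => //.
by rewrite -[X in _ --> X](mulr0 M); apply: cvgM => //; exact: cvg_cst.
Qed.

Lemma cvgsZ H (a : R[i]) (u : nat -> H) l :
  cvgs u l -> cvgs (fun n => a *: u n) (a *: l).
Proof.
apply: (cvgs_lip (f := fun x => a *: x) (M := complex.Re `|a|)) => x y.
by rewrite -scalerBr nrmZ.
Qed.

Lemma cvgsN H (u : nat -> H) l : cvgs u l -> cvgs (fun n => - u n) (- l).
Proof.
by apply: (cvgs_lip (M := 1)) => x y; rewrite mul1r -opprD nrmN.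
Qed.

Lemma cvgs_rdot H (u v : nat -> H) l m :
  cvgs u l -> cvgs v m -> (fun n => rdot (u n) (v n)) @ \oo --> rdot l m.
Proof.
move=> hu hv.
apply: (cvg_dist_squeeze (b := fun n => nrm (u n - l) * nrm (v n - m) +
  nrm (u n - l) * nrm m + nrm l * nrm (v n - m))).
  move=> n; rewrite (_ : _ - _ = rdot (u n - l) (v n - m) + rdot (u n - l) m +
    rdot l (v n - m)); last by rewrite !rdotE; ring.
  apply: le_trans (ler_normD _ _) _; apply: lerD; last exact: rdot_le.
  by apply: le_trans (ler_normD _ _) _; apply: lerD; exact: rdot_le.
rewrite (_ : 0 = 0 * 0 + 0 * nrm m + nrm l * 0); last by rewrite !mul0r mulr0 !addr0.
apply: cvgD; first apply: cvgD.
- exact: cvgM.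
- by apply: cvgM => //; exact: cvg_cst.
- by apply: cvgM => //; exact: cvg_cst.
Qed.

Lemma cvgs_nrm H (u : nat -> H) l : cvgs u l -> (fun n => nrm (u n)) @ \oo --> nrm l.
Proof.
move=> hu; apply: cvg_dist_squeeze hu => n.
rewrite ler_norml lerBlDr lerBrDr.
have := nrmD (u n - l) l; rewrite subrK => ->; rewrite andbT.
by have := nrmD (u n) (l - u n); rewrite [u n + _]addrC subrK nrm_distC; lra.
Qed.

Lemma cvgs_unique H (u : nat -> H) l m : cvgs u l -> cvgs u m -> l = m.
Proof.
move=> hl hm; have h := cvgsD hl (cvgsN hm).
have := cvgs_nrm h; rewrite (_ : (fun n => _) = fun=> 0); last first.
  by apply/funext => n; rewrite subrr nrm0.
move=> /(cvg_unique (@Rhausdorff R) (cvg_cst _)) e.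
by apply/eqP; rewrite -subr_eq0; apply/eqP/nrm_eq0; rewrite -e.
Qed.

Definition cauchys H (u : nat -> H) :=
  forall e : R, 0 < e -> exists N, forall m n, (N <= m)%N -> (N <= n)%N -> nrm (u m - u n) < e.

Lemma ball_nrm H (x y : H) (e : R) : ball x e%:C y = (nrm (x - y) < e) :> Prop.
Proof. by rewrite -ball_normE /ball_ /= normE ltcR. Qed.

Lemma cauchys_cvgs H (u : nat -> H) : cauchys u -> exists l, cvgs u l.
Proof.
move=> hu.
have /cvg_ex[l hl] : cvg (u @ \oo).
  apply: cauchy_cvg; apply/cauchy_ballP => e e0.
  (* Radii are elements of [R[i]]; a positive one is real and can be replaced by its real part. *)
  have eR : e \is Num.real by apply: gtr0_real.
  move: e0; rewrite -(RRe_real eR) ltcR => e0.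
  have [N hN] := hu _ e0.
  exists (u @` [set n | (N <= n)%N], u @` [set n | (N <= n)%N]) => /=.
    by split; exists N => // n /= hn; exists n.
  by move=> [_ _] /= [[m hm <-] [n hn <-]]; rewrite ball_nrm; apply: hN.
exists l; apply/cvgrPdist_lt => e e0.
have ec : 0 < e%:C by rewrite ltcR.
move/cvgrPdist_lt: hl => /(_ _ ec); apply: filterS => n /=.
by rewrite normE ltcR sub0r normrN ger0_norm ?nrm_ge0 // nrm_distC.
Qed.

Lemma cvgs_lt H (u : nat -> H) l : cvgs u l <->
  forall e, 0 < e -> exists N, forall n, (N <= n)%N -> nrm (u n - l) < e.
Proof.
split=> [h e e0|h].
  move/cvgrPdist_lt: h => /(_ _ e0)[N _ hN].
  by exists N => n /hN /=; rewrite sub0r normrN ger0_norm ?nrm_ge0.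
apply/cvgrPdist_lt => e e0; have [N hN] := h _ e0; exists N => // n /= /hN.
by rewrite sub0r normrN ger0_norm ?nrm_ge0.
Qed.

Lemma closure_nrmP H (S : set H) (x : H) :
  closure S x <-> forall e : R, 0 < e -> exists2 y, S y & nrm (x - y) < e.
Proof.
split=> [h e e0|h B /nbhs_ballP[e /= e0 hB]].
  have ec : 0 < e%:C by rewrite ltcR.
  by have [y [Sy]] := h _ (nbhsx_ballx x _ ec); rewrite ball_nrm; exists y.
have eR : e \is Num.real by apply: gtr0_real.
move: e0 hB; rewrite -(RRe_real eR) ltcR => e0 hB.
by have [y Sy xy] := h _ e0; exists y; split => //; apply: hB; rewrite ball_nrm.
Qed.

Lemma inv_cvg0 : (fun n : nat => n.+1%:R^-1 : R) @ \oo --> (0 : R).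
Proof. exact: cvg_harmonic. Qed.

Lemma closureP H (S : set H) (x : H) :
  closure S x <-> exists2 u : nat -> H, forall n, S (u n) & cvgs u x.
Proof.
split=> [/closure_nrmP h|[u hu hx]].
  have /choice[u hu] : forall n : nat, exists y, S y /\ nrm (x - y) < n.+1%:R^-1.
    by move=> n; have [|y] := h n.+1%:R^-1; rewrite ?invr_gt0 //; exists y.
  exists u; first by move=> n; have [] := hu n.
  apply: cvgs_squeeze inv_cvg0 => n.
  by rewrite nrm_distC; apply/ltW; have [] := hu n.
apply/closure_nrmP => e e0; have [N hN] := (cvgs_lt _ _).1 hx _ e0.
by exists (u N) => //; rewrite nrm_distC hN.
Qed.

Lemma closure2P H K (G : set (H * K)) (x : H) (y : K) :
  closure G (x, y) <-> exists u v,
    [/\ forall n : nat, G (u n, v n), cvgs u x & cvgs v y].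
Proof.
split=> [h|[u [v [hG hu hv]]] B].
  have /choice[p hp] : forall n : nat, exists p, [/\ G p, nrm (x - p.1) < n.+1%:R^-1
      & nrm (y - p.2) < n.+1%:R^-1].
    move=> n; have ec : 0 < (n.+1%:R^-1 : R)%:C by rewrite ltcR invr_gt0.
    have [] := h (ball x (n.+1%:R^-1 : R)%:C `*` ball y (n.+1%:R^-1 : R)%:C).
      by exists (ball x (n.+1%:R^-1 : R)%:C, ball y (n.+1%:R^-1 : R)%:C) => //=;
        split; apply: nbhsx_ballx.
    by move=> p [Gp [/= ]]; rewrite !ball_nrm => ? ?; exists p.
  exists (fun n => (p n).1), (fun n => (p n).2); split.
  - by move=> n; have [] := hp n; case: (p n).
  - by apply: cvgs_squeeze inv_cvg0 => n; rewrite nrm_distC; apply/ltW; have [] := hp n.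
  - by apply: cvgs_squeeze inv_cvg0 => n; rewrite nrm_distC; apply/ltW; have [] := hp n.
move=> [[B1 B2] /= [/nbhs_ballP[e /= e0 he] /nbhs_ballP[f /= f0 hf]] hB].
have eR : e \is Num.real by apply: gtr0_real.
have fR : f \is Num.real by apply: gtr0_real.
move: e0 he f0 hf; rewrite -(RRe_real eR) -(RRe_real fR) !ltcR => e0 he f0 hf.
have [N hN] := (cvgs_lt _ _).1 hu _ e0; have [M hM] := (cvgs_lt _ _).1 hv _ f0.
exists (u (maxn N M), v (maxn N M)); split; first exact: hG.
apply: hB; split => /=.
  by apply: he; rewrite ball_nrm nrm_distC hN // leq_maxl.
by apply: hf; rewrite ball_nrm nrm_distC hM // leq_maxr.
Qed.

Lemma denseP H (S : set H) : dense S <-> forall x, closure S x.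
Proof.
split=> [h x B|h O [x Ox] Oo].
  rewrite nbhsE; case=> O [Oo Ox] OB.
  by have [|y [Oy Sy]] := h O _ Oo; [exists x|exists y; split => //; apply: OB].
have [|y [Sy Oy]] := h x O; last by exists y.
by rewrite nbhsE; exists O.
Qed.

End RealInner.

(** A vector identity with real coefficients is tested against an arbitrary vector, where it becomes
    a scalar identity. *)
Ltac vec := let h := fresh in apply: rdot_inj => h; rewrite !rdotE; field.

(** * Closed operators and resolvents *)

Section RealOperators.
Context {R : realType}.
Implicit Types H K L : hilbertType R.

(** Conjugation fixes real scalars, so this notion covers linear and antilinear maps at once. *)
Definition rlinear H K (f : H -> K) :=
  (forall x y, f (x + y) = f x + f y) /\ (forall c x, f (c%:C *: x) = c%:C *: f x).

Definition rlin_op H K (A : operator H K) :=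
  [/\ dom A 0,
      forall x y, dom A x -> dom A y -> dom A (x + y) /\ A (x + y) = A x + A y
    & forall c x, dom A x -> dom A (c%:C *: x) /\ A (c%:C *: x) = c%:C *: A x].

Lemma rlinearB H K (f : H -> K) : rlinear f -> forall x y, f (x - y) = f x - f y.
Proof.
move=> [fD fZ] x y; rewrite fD; congr (_ + _).
by have := fZ (-1) y; rewrite rmorphN1 !scaleN1r.
Qed.

Lemma rlin_opB H K (A : operator H K) x y : rlin_op A -> dom A x -> dom A y ->
  dom A (x - y) /\ A (x - y) = A x - A y.
Proof.
move=> [_ hD hZ] Ax Ay; have := hZ (-1) y Ay; rewrite rmorphN1 !scaleN1r => -[h1 h2].
by have [? ->] := hD _ _ Ax h1; rewrite h2.
Qed.

(** The parallelogram law for [x - u] and [x - v]. On a set stable under midpoints the subtracted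
    term is at least four times the squared distance to [x], so near-minimisers are close to each
    other. *)
Lemma parallelogram_mid H (x u v : H) :
  rdot (u - v) (u - v) = 2 * rdot (x - u) (x - u) + 2 * rdot (x - v) (x - v)
   - 4 * rdot (x - (2^-1)%:C *: (u + v)) (x - (2^-1)%:C *: (u + v)).
Proof. by rewrite !rdotE !(rdotC u) !(rdotC v x); field. Qed.

Lemma nrm_sqr_lt H (x : H) e : 0 < e -> rdot x x < e ^+ 2 -> nrm x < e.
Proof.
by move=> e0; rewrite -sqr_nrm ltr_pXn2r ?nnegrE ?nrm_ge0 // ltW.
Qed.

Lemma linear_quadratic_eq0 (a q : R) :
  0 <= q -> (forall t : R, 2 * t * a <= t ^+ 2 * q) -> a = 0.
Proof.
(* The best [t] would be [a / q]; the shift by 1 allows [q = 0] and still gives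
   [a ^+ 2 * (q + 2) <= 0]. *)
move=> q0 h; have /= := h (a / (q + 1)); have q1 : q + 1 != 0 by lra.
rewrite -(ler_pM2r (x := (q + 1) ^+ 2)); last by apply: exprn_gt0; lra.
rewrite (_ : 2 * _ * _ * _ = 2 * a ^+ 2 * (q + 1)); last by field.
rewrite (_ : _ * q * _ = a ^+ 2 * q); last by field.
move=> h1; have : a ^+ 2 <= 0 by nra.
by move=> h2; apply/eqP; rewrite -sqrf_eq0 eq_le h2 sqr_ge0.
Qed.

(** Two parallelogram laws added up: [a + b] and [c + e] are the squared distances of two
    near-minimisers, [f + g] that of their midpoint, [d] the infimum, [i] and [j] the errors. *)
Lemma near_minimum_dist (a b c e f g d i j : R) :
  a + b < d + i -> c + e < d + j -> d <= f + g ->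
  2 * a + 2 * c - 4 * f + (2 * b + 2 * e - 4 * g) <= 2 * i + 2 * j.
Proof. lra. Qed.

(** The projection theorem for a closed real subspace of [H * K], with the sum of the two real
    products written out. *)
Lemma graph_projection H K (G : set (H * K)) (x : H) (w : K) :
  closed G -> G (0, 0) ->
  (forall p q, G p -> G q -> G (p.1 + q.1, p.2 + q.2)) ->
  (forall c p, G p -> G (c%:C *: p.1, c%:C *: p.2)) ->
  exists2 p, G p & forall g, G g -> rdot (x - p.1) g.1 + rdot (w - p.2) g.2 = 0.
Proof.
move=> Gc G0 GD GZ.
pose q (p : H * K) : R := rdot (x - p.1) (x - p.1) + rdot (w - p.2) (w - p.2).
pose d : R := inf (q @` G).
have qlb : has_lbound (q @` G).
  by exists 0 => _ [p _ <-]; rewrite addr_ge0 ?rdot_ge0.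
have dle p : G p -> d <= q p by move=> Gp; apply: ge_inf => //; exists p.
have /choice[p hp] : forall n : nat, exists p, G p /\ q p < d + (n.+1%:R^-1 : R).
  move=> n; have hi : has_inf (q @` G) by split => //; exists (q (0, 0)), (0, 0).
  by have [|_ [p Gp <-] hp] := inf_adherent (eps := n.+1%:R^-1) _ hi;
    [rewrite invr_gt0|exists p].
clearbody d.
have hpc m n : rdot ((p m).1 - (p n).1) ((p m).1 - (p n).1) +
    rdot ((p m).2 - (p n).2) ((p m).2 - (p n).2) <= 2 * m.+1%:R^-1 + 2 * n.+1%:R^-1.
  have [Gm hm] := hp m; have [Gn hn] := hp n.
  rewrite (parallelogram_mid x) (parallelogram_mid w).
  set a := (2^-1)%:C *: _; set b := (2^-1)%:C *: _.
  have hd : d <= rdot (x - a) (x - a) + rdot (w - b) (w - b).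
    exact: (dle _ (GZ 2^-1 _ (GD _ _ Gm Gn))).
  exact: near_minimum_dist hm hn hd.
have cau : forall e : R, 0 < e -> exists N, forall m n, (N <= m)%N -> (N <= n)%N ->
    2 * m.+1%:R^-1 + 2 * n.+1%:R^-1 < e ^+ 2.
  move=> e e0; have e4 : 0 < e ^+ 2 / 4 by rewrite divr_gt0 ?exprn_gt0.
  have [k] := ltr_add_invr e4.
  rewrite add0r => hk; exists k => m n hm hn.
  have h1 : (m.+1%:R^-1 : R) <= k.+1%:R^-1 by rewrite lef_pV2 ?posrE // ler_nat.
  have h2 : (n.+1%:R^-1 : R) <= k.+1%:R^-1 by rewrite lef_pV2 ?posrE // ler_nat.
  move: hk h1 h2; move: k.+1%:R^-1 m.+1%:R^-1 n.+1%:R^-1 (e ^+ 2) => a b c f; lra.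
have [y hy] : exists y, cvgs (fun n => (p n).1) y.
  apply: cauchys_cvgs => e e0; have [N hN] := cau e e0; exists N => m n hm hn.
  apply: nrm_sqr_lt => //; apply: le_lt_trans (hN m n hm hn).
  by apply: le_trans (hpc m n); rewrite lerDl rdot_ge0.
have [v hv] : exists v, cvgs (fun n => (p n).2) v.
  apply: cauchys_cvgs => e e0; have [N hN] := cau e e0; exists N => m n hm hn.
  apply: nrm_sqr_lt => //; apply: le_lt_trans (hN m n hm hn).
  by apply: le_trans (hpc m n); rewrite lerDr rdot_ge0.
exists (y, v) => [|[h k] Gg /=].
  apply: Gc; apply/closure2P; exists (fun n => (p n).1), (fun n => (p n).2); split => //.
  by move=> n; have [] := hp n; case: (p n).
(* Comparing [p n] with [p n + t (h, k)] gives 2 t a_n <= 1/(n+1) + t^2 (|h|^2 + |k|^2), where a_n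
   is the product of the n-th residual with [(h, k)]. The limit in [n] leaves a linear term below a
   quadratic one. *)
apply: (@linear_quadratic_eq0 _ (rdot h h + rdot k k)); first by rewrite addr_ge0 ?rdot_ge0.
move=> t.
have hb : (fun n : nat => n.+1%:R^-1 + t ^+ 2 * (rdot h h + rdot k k)) @ \oo -->
    t ^+ 2 * (rdot h h + rdot k k).
  by rewrite -[X in _ --> X]add0r; apply: cvgD; [exact: inv_cvg0|exact: cvg_cst].
have ha : (fun n => 2 * t * (rdot (x - (p n).1) h + rdot (w - (p n).2) k)) @ \oo -->
    2 * t * (rdot (x - y) h + rdot (w - v) k).
  apply: cvgM; first exact: cvg_cst.
  by apply: cvgD; apply: cvgs_rdot (cvgs_cst _); apply: cvgsD (cvgs_cst _) _;
    apply: cvgsN.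
suff key (n : nat) : (2 * t * (rdot (x - (p n).1) h + rdot (w - (p n).2) k) : R) <=
    (n.+1%:R^-1 : R) + t ^+ 2 * (rdot h h + rdot k k).
  by apply: (ler_cvg_to ha hb); apply: nearW.
have [Gn] := hp n; have := dle _ (GD _ _ Gn (GZ t _ Gg)).
rewrite /q; case: (p n) => a b /=; rewrite !rdotE.
rewrite (rdotC a x) (rdotC h x) (rdotC h a) (rdotC b w) (rdotC k w) (rdotC k b).
by move: (n.+1%:R^-1 : R) => i; lra.
Qed.

(** The case G = M x {0} of the graph projection, at the point (x, 0). *)
Lemma projection H (M : set H) (x : H) : closed M -> M 0 ->
  (forall y z, M y -> M z -> M (y + z)) -> (forall c y, M y -> M (c%:C *: y)) ->
  exists2 y, M y & forall z, M z -> rdot (x - y) z = 0.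
Proof.
move=> Mc M0 MD MZ.
have [||||[y v] /= [My v0] h] := @graph_projection H H [set p | M p.1 /\ p.2 = 0] x 0.
- move=> [a b] /closure2P[u [v [hG hu hv]]]; split.
    by apply: Mc; apply/closureP; exists u => // n; have [] := hG n.
  apply: (cvgs_unique hv); rewrite (_ : v = fun=> 0); first exact: cvgs_cst.
  by apply/funext => n; have [] := hG n.
- by [].
- by move=> [a b] [c e] [/= Ma ->] [/= Mc' ->]; rewrite addr0; split=> //; apply: MD.
- by move=> c [a b] [/= Ma ->]; rewrite scaler0; split=> //; apply: MZ.
by exists y => // z Mz; have := h (z, 0) (conj Mz erefl) => /=; rewrite rdot0r addr0.
Qed.

Definition radj H K (A : operator H K) (y : K) (u : H) :=
  forall x, dom A x -> rdot (A x) y = rdot x u.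

(** The orthogonal complement of the graph of A consists of the pairs (- A^dag v, v); here v = w - A
    y. The choice w = 0 yields the resolvent, x = 0 the density of the domain of A^dag, and a
    general pair the equality of A with its biadjoint. *)
Lemma graph_decomposition H K (A : operator H K) (x : H) (w : K) :
  rlin_op A -> closed_op A ->
  exists2 y, dom A y & radj A (w - A y) (y - x).
Proof.
move=> lA cA; have [A0 AD AZ] := lA.
have [|||[y v] /= [Ay vE] h] := @graph_projection H K _ x w cA.
- split=> //=; have := AZ 0 0 A0; rewrite rmorph0 !scale0r => -[_ //].
- move=> [a b] [c e] [/= Aa ->] [/= Ac ->].
  by have [h1 h2] := AD _ _ Aa Ac; split.
- by move=> c [a b] [/= Aa ->]; have [h1 h2] := AZ c _ Aa; split.
exists y => // z Az; have := h (z, A z) (conj Az erefl) => /=; rewrite vE !rdotE.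
rewrite !(rdotC _ z) !(rdotC _ (A z)); lra.
Qed.

(** The weak form of (1 + A^dag A) (B x) = x, meaningful before A^dag is known to be an operator. *)
Definition resolvent H K (A : operator H K) (B : H -> H) :=
  forall x, dom A (B x) /\ radj A (A (B x)) (x - B x).

(** * The resolvent of A^dag A *)

Section Resolvent.
Context {H K : hilbertType R} (A : operator H K).
Hypothesis lA : rlin_op A.

Lemma resolvent_exists : closed_op A -> exists B, resolvent A B.
Proof.
move=> cA; suff /choice[B hB] : forall x, exists y, dom A y /\ radj A (A y) (x - y).
  by exists B.
move=> x; have [y Ay h] := graph_decomposition x 0 lA cA.
exists y; split=> // z Az; have := h z Az; rewrite !rdotE; lra.
Qed.

(** For d = y - z the two relations tested on d give |A d|^2 = - |d|^2. *)
Lemma resolvent_unique x y z : dom A y -> radj A (A y) (x - y) ->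
  dom A z -> radj A (A z) (x - z) -> y = z.
Proof.
move=> Ay hy Az hz; have [Ad Ad'] := rlin_opB lA Ay Az.
apply/eqP; rewrite -subr_eq0; apply/eqP/rdot_eq0.
have := hy _ Ad; have := hz _ Ad; rewrite Ad'.
have := rdot_ge0 (A y - A z); have := rdot_ge0 (y - z); rewrite !rdotE; lra.
Qed.

Context {B : H -> H}.
Hypothesis hB : resolvent A B.

Lemma resolvent_eq x y : dom A y -> radj A (A y) (x - y) -> B x = y.
Proof. by move=> Ay hy; have [h1 h2] := hB x; apply: resolvent_unique hy. Qed.

Lemma resolvent_linear : rlinear B.
Proof.
have [_ AD AZ] := lA.
split=> [x y|c x].
  have [Ax hx] := hB x; have [Ay hy] := hB y; have [h1 h2] := AD _ _ Ax Ay.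
  apply: resolvent_eq => // z Az; rewrite h2; have := hx z Az; have := hy z Az.
  rewrite !rdotE; lra.
have [Ax hx] := hB x; have [h1 h2] := AZ c _ Ax.
apply: resolvent_eq => // z Az; rewrite h2; have := hx z Az.
by rewrite !rdotE => ->; ring.
Qed.

(** Both sides equal <B x, B y> + <A B x, A B y>. *)
Lemma resolvent_sym x y : rdot (B x) y = rdot x (B y).
Proof.
have [Ax hx] := hB x; have [Ay hy] := hB y.
have := hx _ Ay; have := hy _ Ax; rewrite !rdotE.
by rewrite (rdotC (A (B x))) (rdotC (B x) (B y)) (rdotC x); lra.
Qed.

(** The right side involves [B] only, so operators with the same resolvent have equal norms on its
    range. It also gives |x|^2 = |B x|^2 + |x - B x|^2 + 2 |A B x|^2, which bounds both [B] and 1 -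
    [B]. *)
Lemma resolvent_graph_norm x :
  rdot (A (B x)) (A (B x)) = rdot (B x) (x - B x).
Proof. by have [Ax hx] := hB x; apply: hx. Qed.

Lemma resolvent_contr x : nrm (B x) <= nrm x.
Proof.
have h1 := resolvent_graph_norm x; have h2 := rdot_ge0 (A (B x)).
have h3 := rdot_ge0 (x - B x).
by apply: nrm_leP; move: h1 h2 h3; rewrite !rdotE (rdotC x (B x)); lra.
Qed.

Lemma resolvent_compl_contr x : nrm (x - B x) <= nrm x.
Proof.
have h1 := resolvent_graph_norm x; have h2 := rdot_ge0 (A (B x)).
have h3 := rdot_ge0 (B x).
by apply: nrm_leP; move: h1 h2 h3; rewrite !rdotE (rdotC x (B x)); lra.
Qed.

Lemma dense_orthogonal (D : set H) x : dense D -> (forall y, D y -> rdot x y = 0) -> x = 0.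
Proof.
move=> /denseP/(_ x)/closureP[u Du ux] h; apply: rdot_eq0.
have := cvgs_rdot (cvgs_cst x) ux; rewrite (_ : (fun _ => _) = fun=> 0); last first.
  by apply/funext => n; apply: h.
by move=> /(cvg_unique (@Rhausdorff R) (cvg_cst _)).
Qed.

Lemma resolvent_inj x : dense (dom A) -> B x = 0 -> x = 0.
Proof.
move=> dA Bx0; apply: (dense_orthogonal dA) => y Ay.
have [A0 hx] := hB x; have := hx y Ay.
have [_ _ /(_ 0 _ A0)[_]] := lA; rewrite Bx0 subr0 rmorph0 !scale0r => ->.
by rewrite rdot0r rdotC => <-.
Qed.

(** Suppose that (d, A d) is orthogonal to all pairs (B z, A B z). The resolvent relation turns <d,
    B z> + <A d, A B z> into <d, z>, and z = d gives d = 0. This is applied to the residual of (x, A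
    x) projected on the closure of these pairs. *)
Lemma resolvent_core x : closed_op A -> dom A x ->
  exists z : nat -> H, cvgs (fun n => B (z n)) x /\ cvgs (fun n => A (B (z n))) (A x).
Proof.
move=> cA Ax; pose G := [set p | exists z, p = (B z, A (B z))].
have [BD BZ] := resolvent_linear; have [_ AD AZ] := lA.
have GsA p : closure G p -> dom A p.1 /\ p.2 = A p.1.
  by move=> h; apply: cA; apply: closure_subset h => _ [z ->]; have [] := hB z.
have [||||p Gp hp] := @graph_projection H K (closure G) x (A x).
- exact: closed_closure.
- apply: subset_closure; exists 0; have := BZ 0 0; rewrite rmorph0 !scale0r => B0.
  have [A0 _] := hB 0; have := AZ 0 _ A0; rewrite rmorph0 !scale0r => -[_ e].
  by rewrite B0 e.
- move=> [a b] [c e] /closure2P[u [v [hG hu hv]]] /closure2P[u' [v' [hG' hu' hv']]].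
  apply/closure2P; exists (fun n => u n + u' n), (fun n => v n + v' n).
  split; [|exact: cvgsD|exact: cvgsD] => n.
  have [z [-> ->]] := hG n; have [z' [-> ->]] := hG' n; exists (z + z').
  have [h1 _] := hB z; have [h2 _] := hB z'.
  by have [_ e'] := AD _ _ h1 h2; rewrite BD e'.
- move=> c [a b] /closure2P[u [v [hG hu hv]]].
  apply/closure2P; exists (fun n => c%:C *: u n), (fun n => c%:C *: v n).
  split; [|exact: cvgsZ|exact: cvgsZ] => n.
  have [z [-> ->]] := hG n; exists (c%:C *: z).
  by have [h1 _] := hB z; have [_ e'] := AZ c _ h1; rewrite BZ e'.
have [Ap pE] := GsA _ Gp; have [Ad Ad'] := rlin_opB lA Ax Ap.
have xp : x = p.1.
  apply/eqP; rewrite -subr_eq0; apply/eqP/rdot_eq0.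
  have [_ h] := hB (x - p.1); have := h _ Ad; rewrite Ad' -pE => h1.
  have : closure G (B (x - p.1), A (B (x - p.1))) by apply: subset_closure; exists (x - p.1).
  by move=> /hp /=; rewrite h1 !rdotE; lra.
have : closure G (x, A x) by rewrite xp -pE; case: (p) Gp.
move=> /closure2P[u [v [hG hu hv]]].
have /choice[z hz] : forall n, exists z, (u n, v n) = (B z, A (B z)) by [].
exists z; split.
  by rewrite (_ : (fun n => _) = u) //; apply/funext => n; have [] := hz n.
by rewrite (_ : (fun n => _) = v) //; apply/funext => n; have [] := hz n.
Qed.

End Resolvent.

Lemma same_resolvent_graph_norm H K L (A : operator H K) (T : operator H L) (B : H -> H) :
  rlin_op A -> closed_op A -> resolvent A B ->
  rlin_op T -> closed_op T -> resolvent T B ->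
  forall x, dom A x -> dom T x /\ nrm (A x) = nrm (T x).
Proof.
move=> lA cA hA lT cT hT x Ax.
have [z [hz hAz]] := resolvent_core lA hA cA Ax.
have isom u : nrm (A (B u)) = nrm (T (B u)).
  by rewrite /nrm (resolvent_graph_norm hA) (resolvent_graph_norm hT).
have lB := resolvent_linear lA hA.
have [y hy] : exists y, cvgs (fun n => T (B (z n))) y.
  apply: cauchys_cvgs => e e0; have e2 : 0 < e / 2 by lra.
  have [N hN] := (cvgs_lt _ _).1 hAz _ e2; exists N => m n hm hn.
  have [_ <-] := rlin_opB lT (hT (z m)).1 (hT (z n)).1.
  rewrite -(rlinearB lB) -isom (rlinearB lB).
  have [_ ->] := rlin_opB lA (hA (z m)).1 (hA (z n)).1.
  apply: le_lt_trans (nrmB_trans (A x) _ _) _; rewrite (nrm_distC (A x)).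
  by have := hN m hm; have := hN n hn; lra.
have [Tx yE] : dom T x /\ y = T x.
  apply: (cT (x, y)); apply/closure2P; exists (fun n => B (z n)), (fun n => T (B (z n))).
  by split=> // n; have [] := hT (z n).
split=> //; rewrite -yE.
have := cvgs_nrm hAz; rewrite (_ : (fun n => _) = fun n => nrm (T (B (z n)))).
  by move=> /(cvg_unique (@Rhausdorff R) (cvgs_nrm hy)).
by apply/funext => n; rewrite isom.
Qed.

End RealOperators.

(** * Square roots of bounded operators *)

Section SquareRoot.
Context {R : realType}.
Implicit Types H K L : hilbertType R.

Definition rbounded H K (f : H -> K) :=
  rlinear f /\ exists M : R, forall x, nrm (f x) <= M * nrm x.

Lemma cvgs_bounded H K (f : H -> K) (u : nat -> H) l :
  rbounded f -> cvgs u l -> cvgs (fun n => f (u n)) (f l).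
Proof.
move=> [lf [M hM]]; apply: (cvgs_lip (M := M)) => x y.
by rewrite -(rlinearB lf).
Qed.

Definition rsym H (f : H -> H) := forall x y, rdot (f x) y = rdot x (f y).

Fixpoint sqrt_iter H (X : H -> H) (n : nat) : H -> H :=
  if n is m.+1 then
    fun x => (2^-1)%:C *: (X x + sqrt_iter X m (sqrt_iter X m x))
  else fun _ => 0.

(** The same iteration for the number X = 1. It dominates the operator iterates and their increments
    in norm, so that its monotone convergence makes them Cauchy. *)
Fixpoint sqrt_majorant (n : nat) : R :=
  if n is m.+1 then 2^-1 * (1 + sqrt_majorant m ^+ 2) else 0.

Lemma sqrt_majorant_itv n : 0 <= sqrt_majorant n <= 1.
Proof.
elim: n => [|n /andP[h0 h1]] /=; first by rewrite lexx ler01.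
by apply/andP; split; nra.
Qed.

(** The increment is (1 - s)^2 / 2. *)
Lemma sqrt_majorant_incr n : sqrt_majorant n <= sqrt_majorant n.+1.
Proof. by have /andP[h0 h1] := sqrt_majorant_itv n; rewrite /=; nra. Qed.

Lemma sqrt_majorant_cauchy (e : R) : 0 < e -> exists N, forall m n,
  (N <= m)%N -> (N <= n)%N -> sqrt_majorant m - sqrt_majorant n < e.
Proof.
move=> e0; have e2 : 0 < e / 2 by rewrite divr_gt0.
have /cvg_ex[s /cvgrPdist_lt/(_ _ e2)[N _ hN]] : cvgn sqrt_majorant.
  apply: nondecreasing_is_cvgn.
    by apply/nondecreasing_seqP => n; exact: sqrt_majorant_incr.
  by exists 1 => _ [n _ <-]; have /andP[] := sqrt_majorant_itv n.
exists N => m n /hN /=; rewrite ltr_distl => /andP[h1 h2] /hN /=.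
by rewrite ltr_distl => /andP[h3 h4]; move: h1 h2 h3 h4; move: (s : R) => r; lra.
Qed.

Lemma sqrt_iter_linear H (X : H -> H) n : rlinear X -> rlinear (sqrt_iter X n).
Proof.
move=> [XD XZ]; elim: n => [|n [ID IZ]] /=; split=> [x y|c x].
- by rewrite addr0.
- by rewrite scaler0.
- by rewrite !ID XD; vec.
- by rewrite !IZ XZ; vec.
Qed.

(** Each iterate is a real polynomial in [X], so [Z] may be antilinear and may join two different
    spaces. *)
Lemma sqrt_iter_intertwine H K (X : H -> H) (X' : K -> K) (Z : H -> K) n :
  rlinear Z -> (forall x, Z (X x) = X' (Z x)) ->
  forall x, Z (sqrt_iter X n x) = sqrt_iter X' n (Z x).
Proof.
move=> [ZD ZZ] ZX; elim: n => [|n IH] x /=.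
  by have := ZZ 0 0; rewrite rmorph0 !scale0r.
by rewrite ZZ ZD ZX !IH.
Qed.

(** * Convergence of the square root iteration *)

Section Iteration.
Context {H : hilbertType R} (X : H -> H).
Hypothesis lX : rlinear X.
Hypothesis bX : forall x, nrm (X x) <= nrm x.

Let Y := sqrt_iter X.

Lemma sqrt_iter_comm m n x : Y m (Y n x) = Y n (Y m x).
Proof.
apply: sqrt_iter_intertwine; first exact: sqrt_iter_linear.
by move=> z; apply/esym/sqrt_iter_intertwine.
Qed.

Lemma nrm_half (x : H) : nrm ((2^-1)%:C *: x) = 2^-1 * nrm x.
Proof.
rewrite /nrm rdotZl rdotZr mulrA -expr2 sqrtrM ?sqr_ge0 //.
by rewrite sqrtr_sqr ger0_norm.
Qed.

Lemma sqrt_iter_bound n x : nrm (Y n x) <= sqrt_majorant n * nrm x.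
Proof.
elim: n x => [|n IH] x; first by rewrite /= nrm0 mul0r.
rewrite /Y /= nrm_half -mulrA ler_pM2l ?invr_gt0 // mulrDl mul1r.
apply: le_trans (nrmD _ _) _; apply: lerD; first exact: bX.
apply: le_trans (IH _) _; rewrite expr2 -mulrA ler_wpM2l //.
by have /andP[] := sqrt_majorant_itv n.
Qed.

Lemma sqrt_iter_contr n x : nrm (Y n x) <= nrm x.
Proof.
apply: le_trans (sqrt_iter_bound n x) _; rewrite ler_piMl ?nrm_ge0 //.
by have /andP[] := sqrt_majorant_itv n.
Qed.

(** As the iterates commute, Y_(n+2) - Y_(n+1) = (Y_(n+1) + Y_n) (Y_(n+1) - Y_n) / 2, and the
    majorants factor in the same way. *)
Lemma sqrt_iter_step n x :
  nrm (Y n.+1 x - Y n x) <= (sqrt_majorant n.+1 - sqrt_majorant n) * nrm x.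
Proof.
elim: n x => [|n IH] x; first by have := sqrt_iter_bound 1 x; rewrite subr0 subr0.
have lY k : rlinear (Y k) by exact: sqrt_iter_linear.
have -> : Y n.+2 x - Y n.+1 x =
    (2^-1)%:C *: (Y n.+1 (Y n.+1 x - Y n x) + Y n (Y n.+1 x - Y n x)).
  rewrite !(rlinearB (lY _)) (sqrt_iter_comm n.+1 n x).
  rewrite -[Y n.+2 x]/((2^-1)%:C *: (X x + Y n.+1 (Y n.+1 x))).
  rewrite -[X in _ - X = _]/((2^-1)%:C *: (X x + Y n (Y n x))).
  by vec.
rewrite nrm_half.
have /andP[h0 h1] := sqrt_majorant_itv n; have hi := sqrt_majorant_incr n.
have b1 := sqrt_iter_bound n.+1 (Y n.+1 x - Y n x).
have b2 := sqrt_iter_bound n (Y n.+1 x - Y n x).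
have b3 := nrmD (Y n.+1 (Y n.+1 x - Y n x)) (Y n (Y n.+1 x - Y n x)).
have -> : sqrt_majorant n.+2 - sqrt_majorant n.+1 =
  2^-1 * ((sqrt_majorant n.+1 + sqrt_majorant n) * (sqrt_majorant n.+1 - sqrt_majorant n)).
  transitivity (2^-1 * (1 + sqrt_majorant n.+1 ^+ 2) - 2^-1 * (1 + sqrt_majorant n ^+ 2)).
    by [].
  by ring.
rewrite -mulrA ler_pM2l ?invr_gt0 // -mulrA.
apply: le_trans b3 _; apply: le_trans (lerD b1 b2) _.
rewrite -mulrDl ler_wpM2l // addr_ge0 //.
exact: le_trans hi.
Qed.

Lemma sqrt_iter_dist m n x : (n <= m)%N ->
  nrm (Y m x - Y n x) <= (sqrt_majorant m - sqrt_majorant n) * nrm x.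
Proof.
move=> /subnK <-; elim: (m - n)%N => [|k IH].
  by rewrite add0n !subrr nrm0 mul0r.
rewrite addSn; apply: le_trans (nrmB_trans (Y (k + n) x) _ _) _.
by have := sqrt_iter_step (k + n) x; have := IH; lra.
Qed.

Lemma sqrt_iter_cvg x : exists l, cvgs (fun n => Y n x) l.
Proof.
apply: cauchys_cvgs => e e0.
have x1 : 0 < nrm x + 1 by rewrite ltr_wpDl ?nrm_ge0.
have e1 : 0 < e / (nrm x + 1) by rewrite divr_gt0.
have [N hN] := sqrt_majorant_cauchy e1; exists N.
suff S m n : (N <= n)%N -> (n <= m)%N -> nrm (Y m x - Y n x) < e.
  move=> m n hm hn; have [nm|mn] := leqP n m; first exact: S.
  by rewrite nrm_distC; apply: S => //; exact: ltnW.
move=> hn nm; apply: le_lt_trans (sqrt_iter_dist x nm) _.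
have := hN m n (leq_trans hn nm) hn; rewrite ltr_pdivlMr //.
set d := _ - _; have d0 : 0 <= d.
  rewrite subr_ge0; move: nm => /subnK <-; elim: (m - n)%N => // k IH.
  by rewrite addSn; apply: le_trans IH _; exact: sqrt_majorant_incr.
by move=> h; apply: le_lt_trans h; rewrite ler_wpM2l // lerDl.
Qed.

Lemma sqrt_iter_sym n : rsym X -> rsym (Y n).
Proof.
move=> sX; elim: n => [|n IH] x y; first by rewrite !rdotE.
by rewrite /Y /= !rdotE sX !IH.
Qed.

End Iteration.

Definition sqrt_lim H (X : H -> H) (x : H) : H :=
  xget 0 [set l | cvgs (fun n => sqrt_iter X n x) l].

(* The positive square root of [B], as [1 - Y] where [Y] solves
   [Y = (X + Y ^ 2) / 2] for [X = 1 - B]. *)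
Definition bsqrt H (B : H -> H) (x : H) : H := x - sqrt_lim (fun z => z - B z) x.

Section SqrtLim.
Context {H : hilbertType R} (X : H -> H).
Hypothesis lX : rlinear X.
Hypothesis bX : forall x, nrm (X x) <= nrm x.

Lemma sqrt_lim_cvg x : cvgs (fun n => sqrt_iter X n x) (sqrt_lim X x).
Proof.
have [l hl] := sqrt_iter_cvg lX bX x.
exact: (@xgetPex _ 0 [set l | cvgs (fun n => sqrt_iter X n x) l]) (ex_intro _ l hl).
Qed.

Lemma sqrt_lim_eq x l : cvgs (fun n => sqrt_iter X n x) l -> sqrt_lim X x = l.
Proof. exact: cvgs_unique (sqrt_lim_cvg x). Qed.

Lemma sqrt_lim_linear : rlinear (sqrt_lim X).
Proof.
split=> [x y|c x]; apply: sqrt_lim_eq.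
  rewrite (_ : (fun n => _) = fun n => sqrt_iter X n x + sqrt_iter X n y).
    by apply: cvgsD; exact: sqrt_lim_cvg.
  by apply/funext => n; have [-> _] := sqrt_iter_linear n lX.
rewrite (_ : (fun n => _) = fun n => c%:C *: sqrt_iter X n x).
  by apply: cvgsZ; exact: sqrt_lim_cvg.
by apply/funext => n; have [_ ->] := sqrt_iter_linear n lX.
Qed.

Lemma sqrt_lim_contr x : nrm (sqrt_lim X x) <= nrm x.
Proof.
apply: (ler_cvg_to (cvgs_nrm (sqrt_lim_cvg x)) (cvg_cst _)).
by apply: nearW => n; exact: sqrt_iter_contr.
Qed.

Lemma sqrt_lim_sym : rsym X -> rsym (sqrt_lim X).
Proof.
move=> sX x y; have h1 := cvgs_rdot (sqrt_lim_cvg x) (cvgs_cst y).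
have h2 := cvgs_rdot (cvgs_cst x) (sqrt_lim_cvg y); move: h1.
rewrite (_ : (fun n => _) = fun n => rdot x (sqrt_iter X n y)).
  by move=> h1; exact: (cvg_unique (@Rhausdorff R) h1 h2).
by apply/funext => n; rewrite sqrt_iter_sym.
Qed.

Lemma sqrt_lim_sqr x : sqrt_lim X (sqrt_lim X x) = 2%:C *: sqrt_lim X x - X x.
Proof.
have h := sqrt_lim_cvg x.
have h1 : cvgs (fun n => sqrt_iter X n.+1 x) (sqrt_lim X x).
  apply/cvgs_lt => e e0; have [N hN] := (cvgs_lt _ _).1 h e e0.
  by exists N => n hn; apply: hN; apply: leqW.
(* Pointwise convergence passes to the square because all iterates are contractions. *)
have h2 : cvgs (fun n => sqrt_iter X n (sqrt_iter X n x)) (sqrt_lim X (sqrt_lim X x)).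
  have hh := sqrt_lim_cvg (sqrt_lim X x).
  apply: (cvgs_squeeze (v := fun n => nrm (sqrt_iter X n x - sqrt_lim X x) +
    nrm (sqrt_iter X n (sqrt_lim X x) - sqrt_lim X (sqrt_lim X x)))) => [n|].
    apply: le_trans (nrmB_trans (sqrt_iter X n (sqrt_lim X x)) _ _) _.
    rewrite lerD2r -(rlinearB (sqrt_iter_linear n lX)).
    exact: sqrt_iter_contr.
  by rewrite -[X in _ --> X]addr0; apply: cvgD.
have h3 := cvgsZ (2^-1)%:C (cvgsD (cvgs_cst (X x)) h2).
have := cvgs_unique h1 h3.
by move: (sqrt_lim X x) (sqrt_lim X (sqrt_lim X x)) => b a ->; vec.
Qed.

End SqrtLim.

Lemma sqrt_lim_intertwine H K (X : H -> H) (X' : K -> K) (Z : H -> K) :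
  rlinear X -> (forall x, nrm (X x) <= nrm x) ->
  rlinear X' -> (forall x, nrm (X' x) <= nrm x) ->
  rbounded Z -> (forall x, Z (X x) = X' (Z x)) ->
  forall x, Z (sqrt_lim X x) = sqrt_lim X' (Z x).
Proof.
move=> lX bX lX' bX' bZ ZX x; apply/esym/sqrt_lim_eq => //.
rewrite (_ : (fun n => _) = fun n => Z (sqrt_iter X n x)).
  by apply: cvgs_bounded => //; exact: sqrt_lim_cvg.
by apply/funext => n; rewrite (sqrt_iter_intertwine n bZ.1 ZX).
Qed.

(** The bound is put on 1 - [B], the operator fed to the iteration; it makes [B] both bounded and
    positive, and the square root satisfies it again. *)
Definition contraction_sym H (B : H -> H) :=
  [/\ rlinear B, rsym B & forall x, nrm (x - B x) <= nrm x].

Section BoundedSqrt.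
Context {H : hilbertType R} (B : H -> H).
Hypothesis cB : contraction_sym B.

Let X z := z - B z.

Let lX : rlinear X.
Proof.
by have [[BD BZ] _ _] := cB; split=> [x y|c x]; rewrite /X ?BD ?BZ; vec.
Qed.

Let bX x : nrm (X x) <= nrm x.
Proof. by have [_ _] := cB; apply. Qed.

Let sX : rsym X.
Proof. by have [_ sB _] := cB; move=> x y; rewrite /X !rdotE sB. Qed.

Lemma bsqrt_contraction : contraction_sym (bsqrt B).
Proof.
have [YD YZ] := sqrt_lim_linear lX bX; have sY := sqrt_lim_sym lX bX sX.
split.
- by split=> [x y|c x]; rewrite /bsqrt -/X ?YD ?YZ; vec.
- by move=> x y; rewrite /bsqrt -/X !rdotE sY.
- by move=> x; rewrite /bsqrt subKr; exact: sqrt_lim_contr.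
Qed.

(** (1 - Y)^2 = 1 - 2 Y + Y^2 = 1 - X = B. *)
Lemma bsqrt_sqr x : bsqrt B (bsqrt B x) = B x.
Proof.
rewrite {1}/bsqrt -/X (rlinearB (sqrt_lim_linear lX bX)) sqrt_lim_sqr //.
by rewrite /bsqrt -/X /X; vec.
Qed.

End BoundedSqrt.

Lemma contraction_bounded H (B : H -> H) : contraction_sym B -> rbounded B.
Proof.
move=> [lB _ bB]; split=> //; exists 2 => x.
have := bB x; have := nrmD x (- (x - B x)); rewrite nrmN opprB addrC subrK; lra.
Qed.

Lemma contraction_ge0 H (B : H -> H) x : contraction_sym B -> 0 <= rdot (B x) x.
Proof.
move=> [lB _ /(_ x)bB]; have := rdot_le (x - B x) x.
rewrite ler_norml => /andP[_ h].
have : nrm (x - B x) * nrm x <= nrm x ^+ 2 by rewrite expr2 ler_wpM2r ?nrm_ge0.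
by rewrite sqr_nrm; move: h; rewrite !rdotE; lra.
Qed.

Lemma contraction_compl H (B : H -> H) : contraction_sym B ->
  (forall x, nrm (B x) <= nrm x) -> contraction_sym (fun x => x - B x).
Proof.
move=> [[BD BZ] sB _] bB; split.
- by split=> [x y|c x]; rewrite ?BD ?BZ; vec.
- by move=> x y; rewrite !rdotE sB.
- by move=> x; rewrite subKr.
Qed.

Lemma bsqrt_intertwine H K (B : H -> H) (B' : K -> K) (Z : H -> K) :
  contraction_sym B -> contraction_sym B' -> rbounded Z ->
  (forall x, Z (B x) = B' (Z x)) ->
  forall x, Z (bsqrt B x) = bsqrt B' (Z x).
Proof.
move=> [[BD BZ] _ bB] [[BD' BZ'] _ bB'] bZ ZB x.
rewrite /bsqrt (rlinearB bZ.1); congr (_ - _).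
apply: sqrt_lim_intertwine => //.
- by split=> [u v|c u]; rewrite ?BD ?BZ; vec.
- by split=> [u v|c u]; rewrite ?BD' ?BZ'; vec.
- by move=> u; rewrite (rlinearB bZ.1) ZB.
Qed.

(** With D the root of [B], which commutes with [E], the product is <E D x, D x>. *)
Lemma bsqrt_mul_ge0 H (B E : H -> H) : contraction_sym B -> contraction_sym E ->
  (forall x, B (E x) = E (B x)) -> forall x, 0 <= rdot (B (E x)) x.
Proof.
move=> cB cE BE x; have [_ sD _] := bsqrt_contraction cB.
rewrite -(bsqrt_sqr cB) sD.
have <- := bsqrt_intertwine cB cB (contraction_bounded cE) (fun x => esym (BE x)) x.
exact: contraction_ge0.
Qed.

(** Positivity of the form at z - t E z bounds 2 t |E z|^2 by t^2 <E E z, E z> for every real t. *)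
Lemma positive_form_eq0 H (E : H -> H) z : rlinear E -> rsym E ->
  (forall x, 0 <= rdot (E x) x) -> rdot (E z) z = 0 -> E z = 0.
Proof.
move=> lE sE pE Ez; apply: rdot_eq0.
apply: (linear_quadratic_eq0 (pE (E z))) => t.
have := pE (z - t%:C *: E z); have [_ EZ] := lE.
rewrite (rlinearB lE) EZ !rdotE Ez (sE (E z) z); lra.
Qed.

(** For z = E x - F x, commutation gives (E + F) z = 0. Two nonnegative forms then add up to 0 at z,
    so E z = F z = 0 and |z|^2 = <x, E z - F z> = 0. *)
Lemma positive_sqrt_unique H (E F : H -> H) :
  rlinear E -> rsym E -> (forall x, 0 <= rdot (E x) x) ->
  rlinear F -> rsym F -> (forall x, 0 <= rdot (F x) x) ->
  (forall x, E (F x) = F (E x)) -> (forall x, E (E x) = F (F x)) -> E =1 F.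
Proof.
move=> lE sE pE lF sF pF EF EE x; set z := E x - F x.
have h : E z + F z = 0.
  by rewrite /z (rlinearB lE) (rlinearB lF) EF EE; vec.
have : rdot (E z) z + rdot (F z) z = 0 by rewrite -rdotDl h rdot0l.
have := pE z; have := pF z => p1 p2 p3.
have Ez : E z = 0 by apply: positive_form_eq0 => //; lra.
have Fz : F z = 0 by apply: positive_form_eq0 => //; lra.
apply/eqP; rewrite -subr_eq0; apply/eqP/rdot_eq0; rewrite -/z.
have -> : rdot z z = rdot x (E z) - rdot x (F z) by rewrite -sE -sF -rdotNl -rdotDl.
by rewrite Ez Fz subrr.
Qed.

End SquareRoot.

(** * Adjoints *)

Section Adjoints.
Context {R : realType}.
Implicit Types H K L : hilbertType R.

Lemma linear_rlin H K (T : operator H K) : linear_op T -> rlin_op T.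
Proof.
move=> [[T0 TS] TL]; split=> // [x y Tx Ty|c x Tx].
  by have := TS 1 1 x y Tx Ty; have := TL 1 1 x y Tx Ty; rewrite !scale1r.
have := TS c%:C 0 x x Tx Tx; have := TL c%:C 0 x x Tx Tx.
by rewrite !scale0r !addr0.
Qed.

Lemma conj_real (c : R) : Num.conj (c%:C : R[i]) = c%:C.
Proof. exact: conjc_real. Qed.

Lemma antilinear_rlin H K (A : operator H K) : antilinear_op A -> rlin_op A.
Proof.
move=> [[A0 AS] AL]; split=> // [x y Ax Ay|c x Ax].
  by have := AS 1 1 x y Ax Ay; have := AL 1 1 x y Ax Ay; rewrite !rmorph1 !scale1r.
have := AS c%:C 0 x x Ax Ax; have := AL c%:C 0 x x Ax Ax.
by rewrite conj_real rmorph0 !scale0r !addr0.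
Qed.

Lemma linear_scale H K (T : operator H K) a x : linear_op T -> dom T x ->
  dom T (a *: x) /\ T (a *: x) = a *: T x.
Proof.
move=> [[T0 TS] TL] Tx; have := TS a 0 x x Tx Tx; have := TL a 0 x x Tx Tx.
by rewrite !scale0r !addr0.
Qed.

Lemma antilinear_scale H K (A : operator H K) (a : R[i]) x : antilinear_op A -> dom A x ->
  dom A (a *: x) /\ A (a *: x) = a^* *: A x.
Proof.
move=> [[A0 AS] AL] Ax; have := AS a 0 x x Ax Ax; have := AL a 0 x x Ax Ax.
by rewrite rmorph0 !scale0r !addr0.
Qed.

(** The imaginary part of the complex identity at x is its real part at - i x. *)
Lemma adjoint_relP H K (T : operator H K) y u : linear_op T ->
  adjoint_rel T y u <-> radj T y u.
Proof.
move=> lT; split=> h x Tx; first by rewrite /rdot /cdot (h x Tx).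
rewrite -[LHS]/(cdot _ _) -[RHS]/(cdot _ _) !cdotE h //; congr (_ +i* _).
have [Tix TixE] := linear_scale (- 'i%R) lT Tx.
have := h _ Tix; rewrite TixE !rdotZ_conj !rmorphN /= !conjCi.
by rewrite opprK.
Qed.

(** Here A (i x) = - i A x, so the imaginary part at x is the real part at i x; the exchanged
    arguments of <u, x> absorb the conjugation. *)
Lemma antiadjoint_relP H K (A : operator H K) y u : antilinear_op A ->
  antiadjoint_rel A y u <-> radj A y u.
Proof.
move=> lA; split=> h x Ax; first by rewrite (rdotC x) /rdot /cdot (h x Ax).
rewrite -[LHS]/(cdot _ _) -[RHS]/(cdot _ _) !cdotE h // (rdotC u); congr (_ +i* _).
have [Aix AixE] := antilinear_scale 'i%R lA Ax.
have := h _ Aix; rewrite AixE (rdotZ_conj _ (A x)) conjCK => ->; exact: rdotC.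
Qed.

Lemma radj_unique H K (A : operator H K) y u v : densely_defined A ->
  radj A y u -> radj A y v -> u = v.
Proof.
move=> dA hu hv; apply/eqP; rewrite -subr_eq0; apply/eqP.
apply: (dense_orthogonal dA) => x Ax.
by rewrite !rdotE !(rdotC _ x) -hu // -hv // subrr.
Qed.

Lemma adjointP H K (T : operator H K) y u : linear_op T -> densely_defined T ->
  radj T y u <-> dom (adjoint T) y /\ adjoint T y = u.
Proof.
move=> lT dT; have key : dom (adjoint T) y -> radj T y (adjoint T y).
  by move=> hy; apply/adjoint_relP => //; exact: (xgetPex 0 hy).
split=> [h|[hy <-]]; last exact: key.
have hy : dom (adjoint T) y by exists u; apply/adjoint_relP.
by split=> //; apply: (radj_unique dT _ h); apply: key.
Qed.

Lemma antiadjointP H K (A : operator H K) y u : antilinear_op A -> densely_defined A ->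
  radj A y u <-> dom (antiadjoint A) y /\ antiadjoint A y = u.
Proof.
move=> lA dA; have key : dom (antiadjoint A) y -> radj A y (antiadjoint A y).
  by move=> hy; apply/antiadjoint_relP => //; exact: (xgetPex 0 hy).
split=> [h|[hy <-]]; last exact: key.
have hy : dom (antiadjoint A) y by exists u; apply/antiadjoint_relP.
by split=> //; apply: (radj_unique dA _ h); apply: key.
Qed.

(** The last clause is maximality: the adjoint is contained in the symmetric operator [T]. *)
Definition rselfadj H (T : operator H H) :=
  [/\ rlin_op T, forall x y, dom T x -> dom T y -> rdot (T x) y = rdot x (T y)
    & forall y u, radj T y u -> dom T y /\ T y = u].

Lemma selfadjoint_rselfadj H (T : operator H H) : selfadjoint T -> rselfadj T.
Proof.
move=> [lT dT [eD eT]]; split; first exact: linear_rlin.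
  move=> x y Tx Ty; rewrite -eD in Ty.
  by have [_ /(_ (conj Ty (eT _ Ty)))] := adjointP y (T y) lT dT; apply.
move=> y u /(adjointP _ _ lT dT)[]; rewrite eD => Ty <-.
by rewrite eT // eD.
Qed.

Lemma rselfadj_selfadjoint H (T : operator H H) :
  linear_op T -> densely_defined T -> rselfadj T -> selfadjoint T.
Proof.
move=> lT dT [rT sT mT]; split=> //.
have e y : dom T y -> dom (adjoint T) y /\ adjoint T y = T y.
  by move=> Ty; apply/adjointP => // x Tx; exact: sT.
split; last by move=> y [u] /adjoint_relP-/(_ lT)/mT[/e[_ ->]].
apply/seteqP; split=> y; last by move=> /e[].
by move=> [u] /adjoint_relP-/(_ lT)/mT[].
Qed.

Lemma rselfadj_closed H (T : operator H H) : rselfadj T -> closed_op T.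
Proof.
move=> [lT sT mT] [x y] /closure2P[u [v [hG hu hv]]] /=.
suff /mT[? ->] : radj T x y by [].
move=> z Tz; have := cvgs_rdot (cvgs_cst (T z)) hu.
rewrite (_ : (fun n => _) = fun n => rdot z (v n)).
  by move=> h; exact: (cvg_unique (@Rhausdorff R) h (cvgs_rdot (cvgs_cst z) hv)).
by apply/funext => n; have [/= Tu ->] := hG n; exact: sT.
Qed.

Lemma closure_rsubspace H (M : set H) :
  (forall y z, M y -> M z -> M (y + z)) -> (forall (c : R) y, M y -> M (c%:C *: y)) ->
  (forall y z, closure M y -> closure M z -> closure M (y + z)) /\
  (forall (c : R) y, closure M y -> closure M (c%:C *: y)).
Proof.
move=> MD MZ; split.
  move=> y z /closureP[u Mu hu] /closureP[v Mv hv]; apply/closureP.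
  by exists (fun n => u n + v n); [move=> n; exact: MD|exact: cvgsD].
move=> c y /closureP[u Mu hu]; apply/closureP.
by exists (fun n => c%:C *: u n); [move=> n; exact: MZ|exact: cvgsZ].
Qed.

Lemma closure_projection H (M : set H) (x : H) : M 0 ->
  (forall y z, M y -> M z -> M (y + z)) -> (forall (c : R) y, M y -> M (c%:C *: y)) ->
  exists2 y, closure M y & forall z, closure M z -> rdot (x - y) z = 0.
Proof.
move=> M0 MD MZ; have [cD cZ] := closure_rsubspace MD MZ.
by apply: projection => //; [exact: closed_closure|exact: subset_closure].
Qed.

Lemma range_projection H K (T : operator K H) (x : H) : linear_op T ->
  exists2 p, closure (range_op T) p &
    forall z, closure (range_op T) z -> rdot (x - p) z = 0.
Proof.
move=> /linear_rlin[T0 TD TZ]; apply: closure_projection.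
- by have [h] := TZ 0 _ T0; rewrite rmorph0 !scale0r => e; exists 0.
- by move=> _ _ [y Ty <-] [z Tz <-]; have [h <-] := TD _ _ Ty Tz; exists (y + z).
- by move=> c _ [y Ty <-]; have [h <-] := TZ c _ Ty; exists (c%:C *: y).
Qed.

Lemma orthogonal_dense H (M : set H) : M 0 ->
  (forall y z, M y -> M z -> M (y + z)) -> (forall (c : R) y, M y -> M (c%:C *: y)) ->
  (forall x, (forall y, M y -> rdot x y = 0) -> x = 0) -> dense M.
Proof.
move=> M0 MD MZ h; apply/denseP => x.
have [y cy hy] := closure_projection x M0 MD MZ.
suff /eqP : x - y = 0 by rewrite subr_eq0 => /eqP ->.
by apply: h => z Mz; apply: hy; exact: subset_closure.
Qed.

(** * Uniqueness of the positive root, in terms of the resolvent *)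

Section PositiveRoot.
Context {H : hilbertType R} (B : H -> H).
Hypothesis cB : contraction_sym B.
Hypothesis bB : forall x, nrm (B x) <= nrm x.

Let cB' : contraction_sym (fun x => x - B x) := contraction_compl cB bB.

Let C := bsqrt B.
Let D := bsqrt (fun x => x - B x).

Let cC : contraction_sym C := bsqrt_contraction cB.
Let cD : contraction_sym D := bsqrt_contraction cB'.

Let CC x : C (C x) = B x := bsqrt_sqr cB x.
Let DD x : D (D x) = x - B x := bsqrt_sqr cB' x.

Lemma bsqrt_commute Z : rbounded Z -> (forall x, Z (B x) = B (Z x)) ->
  (forall x, Z (C x) = C (Z x)) /\ (forall x, Z (D x) = D (Z x)).
Proof.
move=> bZ ZB; split; first exact: bsqrt_intertwine.
by apply: bsqrt_intertwine => // x; rewrite (rlinearB bZ.1) ZB.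
Qed.

Lemma bsqrt_compl_comm x : C (D x) = D (C x).
Proof.
have [_ h] := bsqrt_commute (contraction_bounded cC)
  (fun x => esym (bsqrt_intertwine cB cB (contraction_bounded cB) (fun=> erefl) x)).
exact: h.
Qed.

Let CD := bsqrt_compl_comm.

Lemma root_resolvent (T : operator H H) : rselfadj T ->
  (forall x, dom T x -> 0 <= rdot (T x) x) -> resolvent T B ->
  forall x, T (B x) = D (C x).
Proof.
move=> [lT sT mT] pT hB.
have lB : rlinear B by case: cB.
have TB x : dom T (B x) by have [] := hB x.
have TTB x : dom T (T (B x)) /\ T (T (B x)) = x - B x.
  by apply: mT; have [] := hB x.
(* Inserting this splitting of [x] turns symmetry and positivity of [T] on its domain into those of
   the everywhere defined E = T B. *)
have decomp x : x = B x + T (T (B x)) by have [_ ->] := TTB x; rewrite addrC subrK.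
have lE : rlinear (fun x => T (B x)).
  have [BD BZ] := lB; have [_ TD TZ] := lT; split=> [x y|c x].
    by rewrite BD; have [_ ->] := TD _ _ (TB x) (TB y).
  by rewrite BZ; have [_ ->] := TZ c _ (TB x).
have sE : rsym (fun x => T (B x)).
  move=> x y; have [Tx _] := TTB x; have [Ty _] := TTB y.
  transitivity (rdot (T (B x)) (B y) + rdot (T (B x)) (T (T (B y)))).
    by rewrite -rdotDr -decomp.
  rewrite (sT (B x)) // -(sT (T (B x))) // -rdotDl.
  by rewrite -decomp.
have pE x : 0 <= rdot (T (B x)) x.
  rewrite [X in rdot _ X](decomp x) rdotDr; apply: addr_ge0; first exact: pT.
  by rewrite rdotC pT //; have [] := TTB x.
have bE : rbounded (fun x => T (B x)).
  split=> //; exists 1 => x; rewrite mul1r; apply: nrm_leP.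
  rewrite (resolvent_graph_norm hB); have := rdot_ge0 (x - B x).
  have : rdot (B x) (B x) <= rdot x x by rewrite -!sqr_nrm lerXn2r ?nnegrE ?nrm_ge0.
  have := rdot_ge0 (B x); rewrite !rdotE (rdotC x (B x)); lra.
(* [T (B (B x))] solves the equation that defines the resolvent at [T (B x)]. *)
have EB x : T (B (B x)) = B (T (B x)).
  apply/esym; apply: (resolvent_eq lT hB); first by have [] := TTB (B x).
  have [_ ->] := TTB (B x); have [dB <-] := rlin_opB lT (TB x) (TB (B x)).
  by move=> z Tz; apply: sT.
have [EC ED] := bsqrt_commute bE EB.
have [lC sC bC] := cC; have [lD sD bD] := cD.
have lF : rlinear (fun x => D (C x)).
  by split=> [x y|c x] /=; [rewrite lC.1; exact: lD.1|rewrite lC.2; exact: lD.2].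
have sF : rsym (fun x => D (C x)) by move=> x y /=; rewrite sD sC CD.
have pF : forall x, 0 <= rdot (D (C x)) x.
  exact: (bsqrt_mul_ge0 cD cC (fun x => esym (CD x))).
have EF x : T (B (D (C x))) = D (C (T (B x))) by rewrite ED EC.
(* Both squares are B (1 - B). *)
have EE x : T (B (T (B x))) = D (C (D (C x))).
  by rewrite -EB; have [_ ->] := TTB (B x); rewrite CD DD CC.
exact: (positive_sqrt_unique lE sE pE lF sF pF EF EE).
Qed.

End PositiveRoot.

End Adjoints.

(** * The absolute value *)

Section AbsoluteValue.
Context {R : realType}.
Implicit Types H K L : hilbertType R.

(** The map C x |-> D x for the roots C of [B] and D of 1 - [B]. When [B] is injective so is C, and
    [xget] has a single preimage to pick. *)
Definition root_op H (B : H -> H) : operator H H :=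
  Operator (range (bsqrt B))
    (fun y => bsqrt (fun x => x - B x) (xget 0 [set z | bsqrt B z = y])).

(** * Existence of the positive root *)

Section RootOp.
Context {H : hilbertType R} (B : H -> H).
Hypothesis cB : contraction_sym B.
Hypothesis bB : forall x, nrm (B x) <= nrm x.
Hypothesis iB : forall x, B x = 0 -> x = 0.

Let cB' : contraction_sym (fun x => x - B x) := contraction_compl cB bB.

Let C := bsqrt B.
Let D := bsqrt (fun x => x - B x).

Let cC : contraction_sym C := bsqrt_contraction cB.
Let cD : contraction_sym D := bsqrt_contraction cB'.
Let lC : rlinear C. Proof. by case: cC. Qed.
Let lD : rlinear D. Proof. by case: cD. Qed.
Let sC : rsym C. Proof. by case: cC. Qed.
Let sD : rsym D. Proof. by case: cD. Qed.
Let CC x : C (C x) = B x := bsqrt_sqr cB x.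
Let DD x : D (D x) = x - B x := bsqrt_sqr cB' x.
Let CD x : C (D x) = D (C x) := bsqrt_compl_comm cB bB x.

Let T := root_op B.

Let C0 x : C x = 0 -> x = 0.
Proof.
move=> Cx; apply: iB; rewrite -CC Cx.
by have := lC.2 0 0; rewrite rmorph0 !scale0r.
Qed.

Lemma root_opE z : T (C z) = D z.
Proof.
congr (D _); have h := @xgetPex _ 0 [set w | C w = C z] (ex_intro _ z erefl).
by apply/eqP; rewrite -subr_eq0; apply/eqP/C0; rewrite (rlinearB lC) h subrr.
Qed.

Lemma root_op_rlin : rlin_op T.
Proof.
split.
- by exists 0 => //; have := lC.2 0 0; rewrite rmorph0 !scale0r.
- move=> _ _ [x _ <-] [y _ <-]; rewrite -lC.1; split; first by exists (x + y).
  by rewrite !root_opE; exact: lD.1.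
- move=> c _ [x _ <-]; rewrite -lC.2; split; first by exists (c%:C *: x).
  by rewrite !root_opE; exact: lD.2.
Qed.

Lemma root_op_linear : (forall (a : R[i]) x, B (a *: x) = a *: B x) -> linear_op T.
Proof.
move=> BZ.
(* Multiplication by a complex scalar is a bounded real-linear map commuting with [B], hence with
   both roots. *)
have bZ (a : R[i]) : rbounded (fun x : H => a *: x).
  split; first by split=> [x y|c x]; rewrite ?scalerDr // !scalerA mulrC.
  by exists (complex.Re `|a|) => x; rewrite nrmZ.
have CZ (a : R[i]) x : C (a *: x) = a *: C x.
  by have [h _] := bsqrt_commute cB bB (bZ a) (fun x => esym (BZ a x)); exact/esym/h.
have DZ (a : R[i]) x : D (a *: x) = a *: D x.
  by have [_ h] := bsqrt_commute cB bB (bZ a) (fun x => esym (BZ a x)); exact/esym/h.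
have [T0 _ _] := root_op_rlin.
have e a b x y : a *: C x + b *: C y = C (a *: x + b *: y) by rewrite -!CZ lC.1.
split; first split=> //.
  by move=> a b _ _ [x _ <-] [y _ <-]; exists (a *: x + b *: y).
move=> a b _ _ [x _ <-] [y _ <-]; rewrite e !root_opE -!DZ; exact: lD.1.
Qed.

Lemma root_op_dense : dense (dom T).
Proof.
have [T0 TD TZ] := root_op_rlin; apply: orthogonal_dense => //.
- by move=> y z /TD h /h[].
- by move=> c y /TZ-/(_ c)[].
move=> x hx; apply: C0; apply: rdot_eq0; rewrite sC.
by apply: hx; exists (C x).
Qed.

Lemma root_op_rselfadj : rselfadj T.
Proof.
split; first exact: root_op_rlin.
  by move=> _ _ [x _ <-] [y _ <-]; rewrite !root_opE sD sC CD.
move=> y u h; have hyu : D y = C u.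
  apply: rdot_inj => z; have := h (C z) (ex_intro2 _ _ z I erefl).
  by rewrite root_opE sD sC !(rdotC z).
(* From [D y = C u], C D = D C and C^2 + D^2 = 1 it follows that C z = y and D z = u. *)
pose z := C y + D u.
have Cz : C z = y.
  by rewrite lC.1 CC CD -hyu DD addrC subrK.
have Dz : D z = u.
  by rewrite lD.1 -CD hyu CC DD addrC subrK.
by rewrite -Cz root_opE; split=> //; exists z.
Qed.

Lemma root_op_ge0 x : dom T x -> 0 <= rdot (T x) x.
Proof.
move=> [z _ <-]; rewrite root_opE -sC.
by apply: bsqrt_mul_ge0 => // w; exact: CD.
Qed.

Lemma root_op_sqr y : dom (comp_op T T) y <-> exists x, y = B x.
Proof.
split=> [[[x _ <-] h]|[x ->]].
  (* Membership means D x = C w for some w; then C x = C (C C x + D C w) = B (C x + D w). *)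
  have {h} : dom T (T (C x)) by exact: h.
  rewrite root_opE => -[w _ hw]; exists (C x + D w).
  by rewrite -CC lC.1 CC CD (_ : C w = D x) // DD addrC subrK.
rewrite -CC; split; first by exists (C x).
by rewrite root_opE -CD; exact: (ex_intro2 _ _ (D x) I erefl).
Qed.

Lemma root_op_sqrE x : T (T (B x)) = x - B x.
Proof. by rewrite -CC root_opE -CD root_opE DD CC. Qed.

End RootOp.

(** * The absolute value and its resolvent *)

Section Abs.
Context {H K : hilbertType R} (A : operator H K).
Hypothesis hlin : antilinear_op A.
Hypothesis hdense : densely_defined A.
Context {B : H -> H}.
Hypothesis hB : resolvent A B.

Let rA : rlin_op A := antilinear_rlin hlin.
Let bB : forall x, nrm (B x) <= nrm x := resolvent_contr hB.
Let iB x : B x = 0 -> x = 0. Proof. exact: (resolvent_inj rA hB). Qed.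

Lemma resolvent_contraction : contraction_sym B.
Proof.
split; [exact: (resolvent_linear rA hB)|exact: (resolvent_sym hB)|].
exact: (resolvent_compl_contr hB).
Qed.

Let cB := resolvent_contraction.

Let S := comp_op (antiadjoint A) A.

Lemma resolvent_dom x : dom S (B x) /\ S (B x) = x - B x.
Proof.
have [Ax /(antiadjointP _ _ hlin hdense)[h1 h2]] := hB x.
by split.
Qed.

Lemma dom_resolvent y : dom S y -> y = B (y + S y).
Proof.
move=> [Ay ASy]; apply/esym/(resolvent_eq rA hB) => //.
by rewrite addrC addKr; apply/antiadjointP.
Qed.

(** A^dag A is complex linear because two conjugations cancel: the relation for [a *: x] at z is the
    one for x at the conjugate multiple of z. *)
Lemma resolvent_scale (a : R[i]) x : B (a *: x) = a *: B x.
Proof.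
have [Ax hx] := hB x; have [Aax e] := antilinear_scale a hlin Ax.
apply: (resolvent_eq rA hB) => // z Az.
have [Aaz e'] := antilinear_scale (Num.conj a) hlin Az.
rewrite e -scalerBr rdotC rdotZ_conj conjCK rdotC.
by move: (hx _ Aaz); rewrite e' conjCK => ->; rewrite rdotZ_conj conjCK.
Qed.

(** One explicit root shows that the chosen element is a root; other properties of [root_op B] do
    not carry over by themselves. *)
Lemma abs_opP : positive_sqrt S (abs_op A).
Proof.
apply: (@xgetPex _ _ [set T | positive_sqrt S T]).
exists (root_op B).
have sT := root_op_rselfadj cB bB iB.
have lT : linear_op (root_op B) by apply: root_op_linear => //; exact: resolvent_scale.
split.
- by apply: rselfadj_selfadjoint => //; exact: root_op_dense.
(* Positivity includes that <T x, x> is real: symmetry applied to x and i x makes the imaginary part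
   equal to its opposite. *)
- move=> x Tx; rewrite -[inner _ _]/(cdot _ _) cdotE lecE /=.
  rewrite root_op_ge0 // andbT; have [_ sTT _] := sT.
  have [Tix Tixe] := linear_scale 'i%R lT Tx.
  have := sTT _ _ Tx Tix; rewrite Tixe; have := rdotZ_conj 'i%R x (root_op B x).
  rewrite conjCi scaleNr rdotNr (rdotC _ (root_op B x)) => e1 e2; apply/eqP; lra.
split.
  apply/seteqP; split=> y.
    by move=> /root_op_sqr-/(_ cB bB iB)[x ->]; have [] := resolvent_dom x.
  by move=> /dom_resolvent ->; apply/root_op_sqr => //; exists (y + S y).
move=> y /root_op_sqr-/(_ cB bB iB)[x ->].
by have [_ ->] := resolvent_dom x; exact: (root_op_sqrE cB bB iB).
Qed.

Lemma abs_op_spec : [/\ linear_op (abs_op A), rselfadj (abs_op A),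
  forall x, dom (abs_op A) x -> 0 <= rdot (abs_op A x) x & resolvent (abs_op A) B].
Proof.
have [sT pT [dTT eTT]] := abs_opP; have [lT dT _] := sT.
have rT := selfadjoint_rselfadj sT; split=> //.
  by move=> x Tx; have := pT _ Tx; rewrite lecE => /andP[].
move=> x; have [Sx Sxe] := resolvent_dom x.
have [Tx TTx] : dom (comp_op (abs_op A) (abs_op A)) (B x) by rewrite dTT.
split=> // z Tz; have [_ sTT _] := rT; rewrite sTT // -Sxe.
by rewrite -eTT.
Qed.

Lemma abs_op_resolvent x : abs_op A (B x) = bsqrt (fun x => x - B x) (bsqrt B x).
Proof. by have [_ rT pT hT] := abs_op_spec; apply: root_resolvent. Qed.

Lemma abs_op_dom x : closed_op A -> dom A x <-> dom (abs_op A) x.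
Proof.
move=> cA; have [lT rT _ hT] := abs_op_spec.
have [rlT _ _] := rT; have cT := rselfadj_closed rT.
split=> [Ax|Tx].
  by have [] := same_resolvent_graph_norm rA cA hB rlT cT hT Ax.
by have [] := same_resolvent_graph_norm rlT cT hT rA cA hB Tx.
Qed.

Lemma abs_op_norm x : closed_op A -> dom A x -> nrm (A x) = nrm (abs_op A x).
Proof.
move=> cA Ax; have [lT rT _ hT] := abs_op_spec.
have [rlT _ _] := rT; have cT := rselfadj_closed rT.
by have [] := same_resolvent_graph_norm rA cA hB rlT cT hT Ax.
Qed.

End Abs.
End AbsoluteValue.

(** * Phase operators *)

Section Biadjoint.
Context {R : realType} {H K : hilbertType R} (A : operator H K).
Hypothesis hlin : antilinear_op A.
Hypothesis hdense : densely_defined A.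

Let rA : rlin_op A := antilinear_rlin hlin.
Let adP y u : radj A y u <-> dom (antiadjoint A) y /\ antiadjoint A y = u :=
  antiadjointP y u hlin hdense.

Lemma antiadjoint_radj y : dom (antiadjoint A) y -> radj A y (antiadjoint A y).
Proof. by move=> hy; apply/adP. Qed.

Lemma antiadjoint_antilinear : antilinear_op (antiadjoint A).
Proof.
have key (a b : R[i]) y z : dom (antiadjoint A) y -> dom (antiadjoint A) z ->
    radj A (a *: y + b *: z)
      (Num.conj a *: antiadjoint A y + Num.conj b *: antiadjoint A z).
  move=> /antiadjoint_radj hy /antiadjoint_radj hz x Ax.
  have [Aax e] := antilinear_scale a hlin Ax; have [Abx e'] := antilinear_scale b hlin Ax.
  rewrite !rdotDr; have := hy _ Aax; have := hz _ Abx.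
  by rewrite e e' !rdotZ_conj !conjCK => -> ->.
split=> [|a b y z hy hz]; last by have /adP[_ ->] := key a b y z hy hz.
split=> [|a b y z hy hz]; last by have /adP[] := key a b y z hy hz.
by have /adP[] : radj A 0 0 by move=> x _; rewrite !rdot0r.
Qed.

Lemma antiadjoint_closed : closed_op (antiadjoint A).
Proof.
move=> [y u] /closure2P[v [w [hG hv hw]]] /=.
suff /adP[h1 h2] : radj A y u by split; [exact: h1|exact: (esym h2)].
move=> x Ax; have := cvgs_rdot (cvgs_cst (A x)) hv.
rewrite (_ : (fun n => _) = fun n => rdot x (w n)).
  by move=> h; exact: (cvg_unique (@Rhausdorff R) h (cvgs_rdot (cvgs_cst x) hw)).
by apply/funext => n; have [/= /antiadjoint_radj h ->] := hG n; exact: h.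
Qed.

Hypothesis hclosed : closed_op A.

(** For w orthogonal to the domain, decompose (0, w): some a has A^dag (w - A a) = a. Then |w - A
    a|^2 = - <A a, w - A a> = - |a|^2, so a = 0 and w = A 0 = 0. *)
Lemma antiadjoint_dense : densely_defined (antiadjoint A).
Proof.
have [D0 DD DZ] := antilinear_rlin antiadjoint_antilinear.
apply: orthogonal_dense => //.
- by move=> y z /DD h /h[].
- by move=> c y /DZ-/(_ c)[].
move=> w hw; have [a Aa ha] := graph_decomposition 0 w rA hclosed.
rewrite subr0 in ha; have := ha _ Aa; have /adP[/hw + _] := ha.
have := rdot_ge0 (w - A a) => h1 h2 h3.
have /rdot_eq0 a0 : rdot a a = 0.
  by move: h1 h2 h3; rewrite !rdotE (rdotC (A a) w); have := rdot_ge0 a; lra.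
have /rdot_eq0/eqP : rdot (w - A a) (w - A a) = 0.
  by move: h1 h2 h3; rewrite a0 !rdotE (rdotC (A _) w); lra.
rewrite subr_eq0 => /eqP ->; rewrite a0.
by have [A0 _ /(_ 0 _ A0)[_]] := rA; rewrite rmorph0 !scale0r.
Qed.

(** Decomposing (y, u) along the graph of A gives a with A^dag (u - A a) = a - y, and the hypothesis
    yields |u - A a|^2 = - |a - y|^2. *)
Lemma biadjoint_radj y u : radj (antiadjoint A) y u -> dom A y /\ A y = u.
Proof.
move=> h; have [a Aa ha] := graph_decomposition y u rA hclosed.
have h1 := ha _ Aa; have /adP[db eb] := ha; have h2 := h _ db; rewrite eb in h2.
have p1 := rdot_ge0 (a - y); have p2 := rdot_ge0 (u - A a).
have e1 : rdot (a - y) (a - y) = 0.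
  move: h1 h2 p1 p2; rewrite !rdotE (rdotC y a) (rdotC u (A a)); lra.
have e2 : rdot (u - A a) (u - A a) = 0.
  move: h1 h2 p1 p2; rewrite !rdotE (rdotC y a) (rdotC u (A a)); lra.
have /eqP := rdot_eq0 e1; have /eqP := rdot_eq0 e2.
by rewrite !subr_eq0 => /eqP -> /eqP <-.
Qed.

End Biadjoint.

(** * The antilinear partial isometry carrying T x to A x *)

Section PhaseConstruction.
Context {R : realType} {H K : hilbertType R} (T : operator H H) (A : operator H K).
Hypothesis lT : linear_op T.
Hypothesis lA : antilinear_op A.
Hypothesis domAT : forall x, dom A x <-> dom T x.
Hypothesis nrmAT : forall x, dom A x -> nrm (A x) = nrm (T x).

Let G : set (H * K) := [set p | exists2 x, dom T x & p = (T x, A x)].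

Lemma isometric_cvg (L M : hilbertType R) (u : nat -> L) (v : nat -> M) l :
  (forall m n, nrm (u m - u n) = nrm (v m - v n)) -> cvgs u l -> exists m, cvgs v m.
Proof.
move=> uv hu; apply: cauchys_cvgs => e e0; have e2 : 0 < e / 2 by rewrite divr_gt0.
have [N hN] := (cvgs_lt _ _).1 hu _ e2; exists N => m n hm hn.
rewrite -uv; apply: le_lt_trans (nrmB_trans l _ _) _; rewrite (nrm_distC l).
by have := hN m hm; have := hN n hn; lra.
Qed.

Let rT := linear_rlin lT.
Let rA := antilinear_rlin lA.

Let distAT x y : dom T x -> dom T y -> nrm (T x - T y) = nrm (A x - A y).
Proof.
move=> Tx Ty; have [Td <-] := rlin_opB rT Tx Ty.
have [Ad <-] := rlin_opB rA ((domAT x).2 Tx) ((domAT y).2 Ty).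
by rewrite nrmAT.
Qed.

Lemma phase_graph_comb (a b : R[i]) p q p' q' :
  closure G (p, q) -> closure G (p', q') ->
  closure G (a *: p + b *: p', Num.conj a *: q + Num.conj b *: q').
Proof.
move=> /closure2P[u [v [hG hu hv]]] /closure2P[u' [v' [hG' hu' hv']]].
apply/closure2P; exists (fun n => a *: u n + b *: u' n).
exists (fun n => Num.conj a *: v n + Num.conj b *: v' n).
split; [|by apply: cvgsD; exact: cvgsZ|by apply: cvgsD; exact: cvgsZ].
move=> n; have [x Tx [-> ->]] := hG n; have [x' Tx' [-> ->]] := hG' n.
exists (a *: x + b *: x'); first by have [[_ TS] _] := lT; exact: TS.
have [_ TL] := lT; have [_ AL] := lA.
by rewrite TL // AL //; apply/domAT.
Qed.

Arguments phase_graph_comb a b {p q p' q'} _ _.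

Lemma phase_graph_nrm p q : closure G (p, q) -> nrm p = nrm q.
Proof.
move=> /closure2P[u [v [hG hu hv]]]; have := cvgs_nrm hu.
rewrite (_ : (fun n => _) = fun n => nrm (v n)).
  by move=> h; exact: (cvg_unique (@Rhausdorff R) h (cvgs_nrm hv)).
apply/funext => n; have [x Tx [-> ->]] := hG n.
by rewrite nrmAT //; apply/domAT.
Qed.

Lemma phase_graph_closure p q : closure G (p, q) ->
  closure (range_op T) p /\ closure (range_op A) q.
Proof.
move=> /closure2P[u [v [hG hu hv]]]; split; apply/closureP.
  by exists u => // n; have [x Tx [-> _]] := hG n; exists x.
by exists v => // n; have [x Tx [_ ->]] := hG n; exists x => //; apply/domAT.
Qed.

Lemma phase_graph_total p : closure (range_op T) p -> exists q, closure G (p, q).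
Proof.
move=> /closureP[u hT hu].
have /choice[x hx] : forall n, exists x, dom T x /\ u n = T x.
  by move=> n; have [x Tx <-] := hT n; exists x.
have [q hq] : exists q, cvgs (fun n => A (x n)) q.
  apply: isometric_cvg hu => m n; have [Tm ->] := hx m; have [Tn ->] := hx n.
  exact: distAT.
exists q; apply/closure2P; exists u, (fun n => A (x n)); split=> // n.
by have [Tn ->] := hx n; exists (x n).
Qed.

Lemma phase_graph_onto q : closure (range_op A) q -> exists p, closure G (p, q).
Proof.
move=> /closureP[u hA hu].
have /choice[x hx] : forall n, exists x, dom T x /\ u n = A x.
  by move=> n; have [x /domAT Tx <-] := hA n; exists x.
have [p hp] : exists p, cvgs (fun n => T (x n)) p.
  apply: isometric_cvg hu => m n; have [Tm ->] := hx m; have [Tn ->] := hx n.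
  by rewrite -distAT.
exists p; apply/closure2P; exists (fun n => T (x n)), u; split=> // n.
by have [Tn ->] := hx n; exists (x n).
Qed.

Let M := closure (range_op T).

Lemma range_op_comb (a b : R[i]) y z : M y -> M z -> M (a *: y + b *: z).
Proof.
move=> /phase_graph_total[q hq] /phase_graph_total[q' hq'].
by have /phase_graph_closure[] := phase_graph_comb a b hq hq'.
Qed.

Arguments range_op_comb a b {y z} _ _.

Let M0 : M 0.
Proof.
have [p Mp _] := range_projection 0 lT.
by have := range_op_comb 0 0 Mp Mp; rewrite !scale0r addr0.
Qed.

Lemma phase_exists : exists U : H -> K,
  [/\ antilinear_partial_isometry U, initial_space U = closure (range_op T),
      final_space U = closure (range_op A)
    & A =op comp_op (everywhere U) T].
Proof.
(* [U x] is the partner of the projection of [x] on the closed range of [T]; equality of norms makes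
   the partner unique. *)
have /choice[U hU] : forall x, exists q, exists2 p, closure G (p, q) &
    forall z, M z -> rdot (x - p) z = 0.
  move=> x; have [p Mp hp] := range_projection x lT.
  by have [q hq] := phase_graph_total Mp; exists q, p.
have UE x p q : closure G (p, q) -> (forall z, M z -> rdot (x - p) z = 0) -> U x = q.
  move=> pq hp; have [p' pq' hp'] := hU x.
  have h := phase_graph_comb 1 (-1) pq pq'.
  rewrite rmorphN1 rmorph1 !scaleN1r !scale1r in h.
  have [Mp _] := phase_graph_closure h.
  have p0 : p - p' = 0.
    apply: rdot_eq0; have := hp _ Mp; have := hp' _ Mp.
    rewrite !rdotE; lra.
  have := phase_graph_nrm h; rewrite p0 nrm0 => /esym/nrm_eq0/eqP.
  by rewrite subr_eq0 => /eqP.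
have U0 x : (forall z, M z -> rdot x z = 0) <-> U x = 0.
  split=> h.
    apply: (UE x 0) => [|z Mz]; last by rewrite subr0 h.
    have [q hq] := phase_graph_total M0.
    by have := phase_graph_comb 0 0 hq hq; rewrite rmorph0 !scale0r !addr0.
  have [p pq hp] := hU x; move: hp; have := phase_graph_nrm pq.
  by rewrite h nrm0 => /nrm_eq0 ->; rewrite subr0.
have UM x : M x -> closure G (x, U x).
  move=> Mx; have [q hq] := phase_graph_total Mx.
  by rewrite (UE x x q) // => z _; rewrite subrr rdot0l.
have Ulin (a b : R[i]) x y : U (a *: x + b *: y) = Num.conj a *: U x + Num.conj b *: U y.
  have [p pq hp] := hU x; have [p' pq' hp'] := hU y.
  apply: UE (phase_graph_comb a b pq pq') _ => z Mz.
  rewrite opprD addrACA -!scalerBr rdotDl !rdotZ_conj.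
  have MZ (c : R[i]) : M (c *: z).
    by have := range_op_comb c 0 Mz Mz; rewrite scale0r addr0.
  by rewrite hp // hp' // addr0.
have Uinit : initial_space U = M.
  apply/seteqP; split=> x.
    move=> hx; have [p Mp hp] := range_projection x lT.
    (* [x - p] lies in the kernel, so it is orthogonal to [x]; it is also orthogonal to [p], hence
       to itself. *)
    have /U0 /hx : forall z, M z -> rdot (x - p) z = 0 by [].
    move=> /(congr1 (@complex.Re R)) /= h.
    suff /eqP : x - p = 0 by rewrite subr_eq0 => /eqP ->.
    apply: rdot_eq0; rewrite {1}rdotDl rdotNl (rdotC p) hp // subr0; exact: h.
  move=> Mx y hy; rewrite -[inner _ _]/(cdot _ _) cdotE.
  have e1 : rdot x y = 0 by rewrite rdotC; apply: (U0 y).2.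
  have e2 : rdot x ('i%R *: y) = 0.
    rewrite rdotC; apply: (U0 _).2 => //.
    have := Ulin 'i%R 0 y y; rewrite rmorph0 !scale0r !addr0 => ->.
    by rewrite (_ : U y = 0) // scaler0.
  by rewrite e1 e2.
exists U; split=> //.
- split.
  + by split=> [|a b x y _ _]; [split|exact: Ulin].
  + exists 1 => x; rewrite mul1r !normE lecR; have [p pq hp] := hU x.
    rewrite -(phase_graph_nrm pq); apply: nrm_leP.
    have [Mp _] := phase_graph_closure pq; have := hp _ Mp; have := rdot_ge0 (x - p).
    by rewrite !rdotE (rdotC p x); lra.
  + by move=> x; rewrite Uinit => /UM/phase_graph_nrm; rewrite !normE => ->.
- apply/seteqP; split=> [_ [x _ <-]|q /phase_graph_onto[p pq]].
    by have [p /phase_graph_closure[]] := hU x.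
  by exists p => //; apply: (UE p p) => // z _; rewrite subrr rdot0l.
split; first by apply/seteqP; split=> x; [move=> /domAT|move=> [/domAT]].
move=> x /domAT Tx; apply/esym/(UE (T x) (T x)).
  by apply: subset_closure; exists x.
by move=> z _; rewrite subrr rdot0l.
Qed.

End PhaseConstruction.

(** * Partial isometries are determined on a dense part of the initial space *)

Section PhaseUnique.
Context {R : realType} {H K : hilbertType R}.

Lemma isometry_rbounded (U : H -> K) : antilinear_partial_isometry U -> rbounded U.
Proof.
move=> [lU [M hM] _]; split.
  by have [_ UD UZ] := antilinear_rlin lU; split=> [x y|c x];
    [have [] := UD x y I I|have [] := UZ c x I].
(* The constant is complex; comparison in [R[i]] bounds real parts, and that of [M * |x|] is Re M
   times the norm. *)
exists (complex.Re M) => x; have := hM x; rewrite !normE lecE => /andP[_].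
by case: M {hM} => a b /=; rewrite mulr0 subr0.
Qed.

Lemma orthocompl_rdot (D : set H) x : (forall y, D y -> D ('i%R *: y)) ->
  (forall y, D y -> rdot x y = 0) -> orthocompl D x.
Proof.
move=> Di hx y Dy; rewrite -[inner _ _]/(cdot _ _) cdotE hx // hx //.
exact: Di.
Qed.

(** The kernel is closed, hence its own double complement: if n is the projection of x on it, then x
    - n lies in the initial space and is orthogonal to both x and n. *)
Lemma isometry_null (U : H -> K) x : antilinear_partial_isometry U ->
  (forall z, initial_space U z -> rdot x z = 0) -> U x = 0.
Proof.
move=> hU hx; have bU := isometry_rbounded hU; have [lU _ _] := hU.
have U0 : U 0 = 0 by have := bU.1.2 0 0; rewrite rmorph0 !scale0r.
have Uscale (a : R[i]) y : U y = 0 -> U (a *: y) = 0.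
  move=> Uy; have [_ e] := antilinear_scale (x := y) a lU I.
  by rewrite [LHS]e /= Uy scaler0.
have Nc : closed (null_space U).
  move=> y /closureP[u hu uy]; apply: (cvgs_unique (cvgs_bounded bU uy)).
  rewrite (_ : (fun n => _) = fun=> 0); first exact: cvgs_cst.
  by apply/funext => n; exact: hu.
have [n Nn hn] : exists2 y, null_space U y & forall z, null_space U z -> rdot (x - y) z = 0.
  apply: projection => //.
  - by move=> y z Ny Nz; rewrite /null_space /= bU.1.1 Ny Nz addr0.
  - by move=> c y Ny; exact: Uscale.
have hr : rdot x (x - n) = 0.
  by apply: hx; apply: orthocompl_rdot => // y Ny; exact: Uscale.
have : rdot (x - n) (x - n) = 0.
  by have := hn _ Nn; move: hr; rewrite !rdotE (rdotC n x); lra.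
by move=> /rdot_eq0/eqP; rewrite subr_eq0 => /eqP ->.
Qed.

Lemma antilinear_isometry_ext (T : operator H H) (U V : H -> K) :
  antilinear_partial_isometry U -> antilinear_partial_isometry V ->
  initial_space U = closure (range_op T) -> initial_space V = closure (range_op T) ->
  linear_op T -> (forall x, dom T x -> U (T x) = V (T x)) -> U = V.
Proof.
move=> hU hV iU iV lT UV; have bU := isometry_rbounded hU; have bV := isometry_rbounded hV.
apply/funext => x; have [p Mp hp] := range_projection x lT.
rewrite -(subrK p x) bU.1.1 bV.1.1.
rewrite (isometry_null hU) ?iU // (isometry_null hV) ?iV //; congr (_ + _).
move: Mp => /closureP[u hu up]; apply: (cvgs_unique (cvgs_bounded bU up)).
rewrite (_ : (fun n => _) = fun n => V (u n)); first exact: cvgs_bounded.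
by apply/funext => n; have [y Ty <-] := hu n; exact: UV.
Qed.

End PhaseUnique.

Section Phase.
Context {R : realType} {H K : hilbertType R} (A : operator H K).
Hypothesis hlin : antilinear_op A.
Hypothesis hdense : densely_defined A.
Hypothesis hclosed : closed_op A.

Lemma phase_operator_unique : exists! U, phase_operator A U.
Proof.
have [B hB] := resolvent_exists (antilinear_rlin hlin) hclosed.
have [lT _ _ _] := abs_op_spec hlin hdense hB.
have [||U hU] := @phase_exists _ _ _ (abs_op A) A lT hlin.
- by move=> x; exact: (abs_op_dom hlin hdense hB).
- by move=> x Ax; exact: (abs_op_norm hlin hdense hB).
exists U; split=> // V [iV inV _ [dV eV]].
have [iU inU _ [dU eU]] := hU.
apply: (antilinear_isometry_ext iU iV inU inV lT) => x Tx.
have Ax : dom A x by apply/(abs_op_dom hlin hdense hB).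
by rewrite -[LHS]/(comp_op (everywhere U) (abs_op A) x) -eU // eV.
Qed.

End Phase.

(** * Resolvents and absolute values of A and A^dag compared *)

Section PhaseAdjoint.
Context {R : realType} {H K : hilbertType R} (A : operator H K).
Hypothesis hlin : antilinear_op A.
Hypothesis hdense : densely_defined A.
Hypothesis hclosed : closed_op A.

Let Ad := antiadjoint A.
Let dlin : antilinear_op Ad := antiadjoint_antilinear hlin hdense.
Let ddense : densely_defined Ad := antiadjoint_dense hlin hdense hclosed.
Let dclosed : closed_op Ad := antiadjoint_closed hlin hdense.
Let rA := antilinear_rlin hlin.
Let rAd := antilinear_rlin dlin.

Section Resolvents.
Context {B : H -> H} {B' : K -> K}.
Hypothesis hB : resolvent A B.
Hypothesis hB' : resolvent Ad B'.

Let cB := resolvent_contraction hlin hB.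
Let cB' := resolvent_contraction dlin hB'.
Let bB : forall x, nrm (B x) <= nrm x := resolvent_contr hB.
Let bB' : forall x, nrm (B' x) <= nrm x := resolvent_contr hB'.

(** For w = A^dag B' q the biadjoint gives A w = q - B' q; add the resolvent relation of [p] tested
    on w to the adjoint relation between [B p] and [B' q]. *)
Lemma resolvent_adjoint p q : rdot (A (B p)) q = rdot p (Ad (B' q)).
Proof.
have [AB hAB] := hB p; have [AdB hAdB] := hB' q.
have [Aw ew] := biadjoint_radj hlin hdense hclosed hAdB.
have e1 := antiadjoint_radj hlin hdense AdB AB.
have e2 := hAB _ Aw; rewrite ew in e2.
by move: e1 e2; rewrite -/Ad !rdotE (rdotC q) (rdotC (B' q)) !(rdotC (Ad _)); lra.
Qed.

(** A (1 + A^dag A)^-1 = (1 + A A^dag)^-1 A, applied to [B p] so that A B appears as a bounded map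
    on both sides. *)
Lemma resolvent_intertwine p : A (B (B p)) = B' (A (B p)).
Proof.
have [AB hAB] := hB p; have [ABB hABB] := hB (B p).
have [dABB eABB] := (antiadjointP _ _ hlin hdense).1 hABB.
apply/esym/(resolvent_eq rAd hB') => // z Adz; rewrite eABB.
have [Ad' <-] := rlin_opB rA AB ABB.
by rewrite rdotC -(antiadjoint_radj hlin hdense Adz Ad') rdotC.
Qed.

Lemma resolvent_bounded : rbounded (fun p => A (B p)).
Proof.
have [lB _ _] := cB; split.
  have [_ AD AZ] := rA; split=> [x y|c x].
    by rewrite lB.1; have [_ ->] := AD _ _ (hB x).1 (hB y).1.
  by rewrite lB.2; have [_ ->] := AZ c _ (hB x).1.
exists 1 => x; rewrite mul1r; apply: nrm_leP.
rewrite (resolvent_graph_norm hB); have := rdot_ge0 (x - B x).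
have := rdot_ge0 (B x); have : rdot (B x) (B x) <= rdot x x.
  by rewrite -!sqr_nrm lerXn2r ?nnegrE ?nrm_ge0.
by rewrite !rdotE (rdotC x (B x)); lra.
Qed.

(** The roots D' C' move to the left argument, pass through A B as C D, and A B then moves to the
    right as A^dag B'. *)
Lemma abs_op_cross p q :
  rdot (A (B p)) (abs_op Ad (B' q)) = rdot (abs_op A (B p)) (Ad (B' q)).
Proof.
rewrite (abs_op_resolvent hlin hdense hB) (abs_op_resolvent dlin ddense hB').
have [_ sC _] := bsqrt_contraction cB'.
have [_ sD _] := bsqrt_contraction (contraction_compl cB' bB').
rewrite -sD -sC.
have KC := bsqrt_intertwine cB cB' resolvent_bounded resolvent_intertwine.
have KD := bsqrt_intertwine (contraction_compl cB bB) (contraction_compl cB' bB') resolvent_bounded.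
rewrite -KD; last first.
  by move=> x; rewrite (rlinearB resolvent_bounded.1) resolvent_intertwine.
rewrite -KC resolvent_adjoint.
by rewrite (bsqrt_compl_comm cB bB).
Qed.

End Resolvents.

Lemma abs_op_range_core B x : resolvent A B -> dom (abs_op A) x ->
  exists z : nat -> H, cvgs (fun n => abs_op A (B (z n))) (abs_op A x).
Proof.
move=> hB Tx; have [lT rT _ hT] := abs_op_spec hlin hdense hB; have [rlT _ _] := rT.
by have [z [_ hz]] := resolvent_core rlT hT (rselfadj_closed rT) Tx; exists z.
Qed.

(** The vector r lies in the kernel of |A|, which is the kernel of A, and that is orthogonal to the
    range of A^dag. *)
Lemma range_abs_orth r : (forall z, closure (range_op (abs_op A)) z -> rdot r z = 0) ->
  forall w, closure (range_op Ad) w -> rdot r w = 0.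
Proof.
move=> hr; have [B hB] := resolvent_exists rA hclosed.
have [lT [_ _ mT] _ _] := abs_op_spec hlin hdense hB.
have [Tr Tr0] : dom (abs_op A) r /\ abs_op A r = 0.
  apply: mT => x Tx; rewrite rdot0r rdotC; apply: hr.
  by apply: subset_closure; exists x.
have Ar : dom A r by apply/(abs_op_dom hlin hdense hB).
have Ar0 : A r = 0.
  by apply: nrm_eq0; rewrite (abs_op_norm hlin hdense hB) // Tr0 nrm0.
move=> w /closureP[u hu uw].
have := cvgs_rdot (cvgs_cst r) uw; rewrite (_ : (fun n => _) = fun=> 0).
  by move=> /(cvg_unique (@Rhausdorff R) (cvg_cst _)).
apply/funext => n; have [y Ady <-] := hu n.
by rewrite -(antiadjoint_radj hlin hdense Ady Ar) Ar0 rdot0l.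
Qed.

(** A is contained in its biadjoint; this lets [range_abs_orth], used for A^dag, speak about the
    range of A. *)
Lemma range_biadjoint w : range_op A w -> range_op (antiadjoint Ad) w.
Proof.
move=> [x Ax <-]; have /(antiadjointP _ _ dlin ddense)[dx ex] : radj Ad x (A x).
  by move=> y Ady; rewrite rdotC -(antiadjoint_radj hlin hdense Ady Ax) rdotC.
by exists x.
Qed.

End PhaseAdjoint.

Section PhaseOfAdjoint.
Context {R : realType} {H K : hilbertType R} (A : operator H K).
Hypothesis hlin : antilinear_op A.
Hypothesis hdense : densely_defined A.
Hypothesis hclosed : closed_op A.

Let Ad := antiadjoint A.
Let dlin : antilinear_op Ad := antiadjoint_antilinear hlin hdense.
Let ddense : densely_defined Ad := antiadjoint_dense hlin hdense hclosed.
Let dclosed : closed_op Ad := antiadjoint_closed hlin hdense.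

Lemma phase_radj (U : H -> K) (V : K -> H) :
  phase_operator A U -> phase_operator Ad V ->
  forall x y, rdot (U x) y = rdot x (V y).
Proof.
move=> [iU inU fU [_ eU]] [iV inV fV [_ eV]].
have bU := isometry_rbounded iU; have bV := isometry_rbounded iV.
have [B hB] := resolvent_exists (antilinear_rlin hlin) hclosed.
have [B' hB'] := resolvent_exists (antilinear_rlin dlin) dclosed.
have lim1 (u : nat -> H) z y : cvgs u z ->
    (forall n, rdot (U (u n)) y = rdot (u n) (V y)) -> rdot (U z) y = rdot z (V y).
  move=> uz h; have h1 := cvgs_rdot (cvgs_bounded bU uz) (cvgs_cst y).
  have := cvgs_rdot uz (cvgs_cst (V y)); rewrite (_ : (fun n => _) = fun n => rdot (U (u n)) y).
    exact: (cvg_unique (@Rhausdorff R) h1).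
  by apply/funext => n; rewrite h.
have lim2 (u : nat -> K) z y : cvgs u y ->
    (forall n, rdot (U z) (u n) = rdot z (V (u n))) -> rdot (U z) y = rdot z (V y).
  move=> uy h; have h1 := cvgs_rdot (cvgs_cst (U z)) uy.
  have := cvgs_rdot (cvgs_cst z) (cvgs_bounded bV uy).
  rewrite (_ : (fun n => _) = fun n => rdot (U z) (u n)).
    exact: (cvg_unique (@Rhausdorff R) h1).
  by apply/funext => n; rewrite h.
have UT x : dom A x -> U (abs_op A x) = A x by move=> /eU.
have VT y : dom Ad y -> V (abs_op Ad y) = Ad y by move=> /eV.
have core p q : rdot (U (abs_op A (B p))) (abs_op Ad (B' q)) =
    rdot (abs_op A (B p)) (V (abs_op Ad (B' q))).
  rewrite UT ?VT; [|exact: (hB' q).1|exact: (hB p).1].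
  exact: (abs_op_cross hlin hdense hclosed hB hB').
(* In each argument two limits are taken: from the closure to the range, and from the range to the
   values on the range of the resolvent, where [core] applies. *)
have onM z y : closure (range_op (abs_op A)) z -> closure (range_op (abs_op Ad)) y ->
    rdot (U z) y = rdot z (V y).
  move=> /closureP[u hu uz] /closureP[v hv vy].
  apply: (lim1 _ _ _ uz) => n; have [x Tx <-] := hu n.
  have [s hs] := abs_op_range_core hlin hdense hB Tx.
  apply: (lim1 _ _ _ hs) => m {x Tx hs}.
  apply: (lim2 _ _ _ vy) => k; have [x Tx <-] := hv k.
  have [t ht] := abs_op_range_core dlin ddense hB' Tx.
  by apply: (lim2 _ _ _ ht) => j.
move=> x y.
have [lT _ _ _] := abs_op_spec hlin hdense hB; have [lT' _ _ _] := abs_op_spec dlin ddense hB'.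
(* The remainders x - p and y - q are killed by [U] and [V] and are orthogonal to [V q] and [U p],
   so only [p] and [q] contribute. *)
have [p Mp hp] := range_projection x lT.
have [q Mq hq] := range_projection y lT'.
have Ur : U (x - p) = 0 by apply: isometry_null => //; rewrite inU.
have Vr : V (y - q) = 0 by apply: isometry_null => //; rewrite inV.
have Ux : U x = U p by rewrite -[in LHS](subrK p x) bU.1.1 Ur add0r.
have Vy : V y = V q by rewrite -[in LHS](subrK q y) bV.1.1 Vr add0r.
have e1 : rdot (x - p) (V q) = 0.
  apply: (range_abs_orth hlin hdense hclosed hp).
  by rewrite -fV; exists q.
have e2 : rdot (y - q) (U p) = 0.
  apply: (range_abs_orth dlin ddense dclosed hq).
  apply: (closure_subset (@range_biadjoint _ _ _ _ hlin hdense hclosed)).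
  by rewrite -fU; exists p.
have := onM _ _ Mp Mq; rewrite Ux Vy; move: e1 e2; rewrite !rdotE.
by rewrite (rdotC y) (rdotC q); lra.
Qed.

End PhaseOfAdjoint.

Theorem theorem3 (R : realType) (H1 H2 : hilbertType R) (A : operator H1 H2)
    (hlin : antilinear_op A) (hdense : densely_defined A)
    (hclosed : closed_op A) :
  (exists! U : H1 -> H2, phase_operator A U) /\
  (exists! V : H2 -> H1, phase_operator (antiadjoint A) V) /\
  (forall (U : H1 -> H2) (V : H2 -> H1),
     phase_operator A U -> phase_operator (antiadjoint A) V ->
     antiadjoint (everywhere U) =op everywhere V).
Proof.
split; first exact: phase_operator_unique.
split.
  apply: phase_operator_unique; first exact: antiadjoint_antilinear.
    exact: antiadjoint_dense.
  exact: antiadjoint_closed.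
move=> U V hU hV; have [[lU _ _] _ _ _] := hU.
have dU : densely_defined (everywhere U) by move=> O [x Ox] _; exists x.
have key y : dom (antiadjoint (everywhere U)) y /\ antiadjoint (everywhere U) y = V y.
  apply/antiadjointP => // x _; exact: (phase_radj hlin hdense hclosed hU hV).
by split; [apply/seteqP; split=> y // _; have [] := key y|move=> y _; have [] := key y].
Qed.
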